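(* Assume the following symmetry conditions: all base stations have the same power $P_m=P>0$; $B$ divides $A$, and with $A'=A/B$ the $B\times A$ matrix $\beta=(\beta_{m,k})$ ($\beta_{m,k}>0$) splits into $A'$ consecutive column blocks of size $B\times B$ (block $b$ consisting of columns $(b-1)B+1,\dots,bB$), each of which is strongly symmetric, i.e. every row of the block is a permutation of its first row and every column is a permutation of its first column; and the weights are constant on blocks, $W_k=W'_b$ for $k$ in block $b$, with $0\le W'_1\le\dots\le W'_{A'}$. For $\lambda=(\lambda_1,\dots,\lambda_B)>0$ and $Q_1,\dots,Q_A\ge0$ let $$F^\infty_\lambda(Q_1,\dots,Q_A)=\lim_{N\to\infty}\sum_{b=1}^{A'}\frac{\Delta'_b}{N}\,\mathbb{E}\left[\log\left|I+\Sigma(\lambda)^{-1}\widetilde H_{(b-1)B+1:A}\,\mathbf{Q}_{(b-1)B+1:A}\,\widetilde H_{(b-1)B+1:A}^H\right|\right]$$ (assumed to exist), and $G(\lambda)=\max\{F^\infty_\lambda(Q_1,\dots,Q_A): Q_k\ge0,\ \sum_kQ_k\le\sum_m\lambda_mP_m\}$. Then the minimization of $G(\lambda)$ over $\lambda>0$ (normalized without loss of generality so that $\frac1B\sum_m\lambda_m=1$, since $G$ is invariant to a common scaling of $\lambda$) is achieved at $\lambda_m=1$ for all $m=1,\dots,B$; i.e., in the large-system limit, the min-max weighted sum rate problem with per-base-station power constraints $P$ has the same solution as with the cluster sum-power constraint $\sum_kQ_k\le BP$.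
   Context: Cluster model: $B$ base stations with $\gamma N$ antennas each ($\gamma>0$ fixed, $\gamma N\in\mathbb{Z}$) and $A$ user groups of $N$ users each. $\widetilde H$ is the $\gamma BN\times AN$ random matrix whose $(m,k)$ block ($\gamma N\times N$) is $\beta_{m,k}H_{m,k}$, all entries of all $H_{m,k}$ i.i.d. $\mathcal{CN}(0,1)$; $\widetilde H_k$ is its $k$-th block column and $\widetilde H_{c:A}=[\widetilde H_c,\dots,\widetilde H_A]$. $\mathbf{Q}_{c:A}=\frac1N\operatorname{diag}(Q_cI_N,\dots,Q_AI_N)$ (equal per-user power $Q_k/N$ in group $k$). $\Sigma(\lambda)$ is the block-diagonal matrix with diagonal blocks $\lambda_mI_{\gamma N}$, $m=1,\dots,B$. $\Delta'_b=W'_b-W'_{b-1}$ with $W'_0=0$. The user groups are enumerated so that the weights are nondecreasing in the group index. *)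

(* Defs.v *)
(* mathcomp-analysis (probability) + mathcomp-real-closed (complex). *)
From HB Require Import structures.
From mathcomp Require Import all_boot all_order all_algebra all_fingroup.
From mathcomp Require Import all_classical all_reals all_analysis.
From mathcomp Require Import complex.

Set Implicit Arguments.
Unset Strict Implicit.
Unset Printing Implicit Defensive.

Import Order.TTheory GRing.Theory Num.Theory.
Import numFieldNormedType.Exports.
Local Open Scope classical_set_scope.
Local Open Scope ring_scope.

(* split a row index of 'I_(m*n) into (block, position-in-block) *)
Definition splitI {m n : nat} (k : 'I_(m * n)) : 'I_m * 'I_n :=
  enum_val (cast_ord (esym (mxvec_cast m n)) k).

(* mutual independence of a family of real random variables:
   product rule over every finite subfamily *)
Definition mutually_independent {d} {T : measurableType d} {R : realType}
  (P : probability T R) {I : eqType} (X : I -> {RV P >-> R}) : Prop :=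
  forall (s : seq I) (A : I -> set R), uniq s -> (forall i, measurable (A i)) ->
  P (\bigcap_(i in [set j | j \in s]) (X i @^-1` A i)) =
  (\prod_(i <- s) P (X i @^-1` A i))%E.

(* index of a real coordinate of an entry of the channel array:
   (base station m, user block b, group j within block, antenna a, user u, imaginary part?) *)
Definition idx := (nat * nat * nat * nat * nat * bool)%type.

Local Open Scope complex_scope.
Section Model.
Context {R : realType} {d : measure_display} {T : measurableType d}
  (P : probability T R) (X : idx -> {RV P >-> R}).
Context (B A' p q : nat) (beta : 'I_B -> 'I_A' -> 'I_B -> R).

(* CN(0,1) entry of H_{m,k}, k = group (b,j) *)
Definition gentry (w : T) (m b j a u : nat) : R[i] :=
  Complex (X (m, b, j, a, u, false) w) (X (m, b, j, a, u, true) w).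

(* for n : N = q*n users per group, gamma*N = p*n antennas per BS *)
(* entry of  tilde H  at row (m,a), column (group (b,j), user u) *)
Definition Htil (n : nat) (w : T) (r : 'I_(B * (p * n)))
  (t : 'I_A' * 'I_B * 'I_(q * n)) : R[i] :=
  let m := (splitI r).1 in let a := (splitI r).2 in
  (beta m t.1.1 t.1.2)%:C * gentry w m t.1.1 t.1.2 a t.2.

(* I + Sigma(lam)^{-1} Htil_{c:A} Q_{c:A} Htil_{c:A}^H, where c:A is
   the set of groups in blocks b >= b0 *)
Definition Mmat (lam : 'I_B -> R) (Q : 'I_A' -> 'I_B -> R) (b0 n : nat) (w : T) :
  'M[R[i]]_(B * (p * n)) :=
  \matrix_(r, r')
    ((r == r')%:R + ((lam (splitI r).1)^-1)%:C *
      \sum_(t : 'I_A' * 'I_B * 'I_(q * n) | (b0 <= t.1.1)%N)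
         @Htil n w r t * (Q t.1.1 t.1.2 / (q * n)%:R)%:C * (@Htil n w r' t)^*).

(* log-determinant (the determinant is real positive) *)
Definition logdet (lam : 'I_B -> R) (Q : 'I_A' -> 'I_B -> R) (b0 n : nat) (w : T) : R :=
  ln (complex.Re (\det (Mmat lam Q b0 n w))).

Definition ElogDet lam Q b0 n : R := fine (\int[P]_w (logdet lam Q b0 n w)%:E)%E.

(* Delta'_b = W'_b - W'_{b-1}, with 0-based blocks and W'_{-1} = 0 *)
Definition Delta (W' : nat -> R) (b : nat) : R :=
  W' b - (if b is b'.+1 then W' b' else 0).

(* the finite-N objective, N = q*n *)
Definition Fn (W' : nat -> R) lam Q (n : nat) : R :=
  \sum_(b < A') Delta W' b / (q * n)%:R * ElogDet lam Q b n.

Definition Finf W' lam Q : R := limn (Fn W' lam Q).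

Definition feasible (Pw : R) (lam : 'I_B -> R) : set ('I_A' -> 'I_B -> R) :=
  [set Q | (forall b j, 0 <= Q b j) /\
           \sum_b \sum_j Q b j <= \sum_m lam m * Pw].

Definition Gfun W' Pw lam : \bar R :=
  ereal_sup [set (Finf W' lam Q)%:E | Q in feasible Pw lam].

End Model.

(* Main.v *)
Require Import Defs.
From HB Require Import structures.
From mathcomp Require Import all_boot all_order all_algebra all_fingroup.
From mathcomp Require Import spectral sesquilinear ring lra.
From mathcomp Require Import all_classical all_reals all_analysis.
From mathcomp Require Import measurable_realfun complex.

Set Implicit Arguments.
Unset Strict Implicit.
Unset Printing Implicit Defensive.

Import Order.TTheory GRing.Theory Num.Theory.
Import numFieldNormedType.Exports.
Local Open Scope classical_set_scope.
Local Open Scope ring_scope.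

(* Replacing feasible powers [Q] by their block means [Qb] keeps them feasible for
   every normalized [lam], so it suffices to show F_1(Q) <= F_lam(Qb) in the limit.
   Let G be the power-scaled channel at (1, Qb), K = (1 + G G^H)^-1 and
   L = (1 + G^H G)^-1. Tangent inequalities for log det give, for every channel,
     logdet_1(Q)  <= logdet_1(Qb)   + sum_c kappa_c (1 - L_cc),   Q = (1 + kappa) Qb,
     logdet_1(Qb) <= logdet_lam(Qb) + sum_r (lam_r - 1) (1 - K_rr).
   As kappa sums to 0 over each block and lam - 1 sums to 0, both corrections are
   controlled by how much the group averages of L_cc and the base-station averages
   of K_rr differ inside a block. By column removal and a variance bound for
   quadratic forms, these diagonals satisfy x = 1/(1 + v t), t = 1/(1 + u x) up to an
   error that is o(1) in mean; the row and column sums of v and u being constant on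
   blocks (strong symmetry), the approximate solutions are nearly constant on blocks. *)

(** * Stability of the block fixed-point equations *)

(** What strong symmetry gives in every block is constant row and column sums of squared gains, and
    these control the log-determinants only to leading order in N. Hence the comparison carries an
    error o(N), absorbed by the factor 1/N of the objective. Both tangents are taken at the same
    point (1, Qb), so one pair of resolvents serves both corrections. No limiting value is
    identified: for each channel the random diagonals themselves solve the equations up to a
    residual, the stability argument is purely algebraic, and only the residual is estimated in
    mean. The probabilistic estimates keep a free [eps], in the form eps + (1 + 1/eps)/n, which
    suffices for a limit. *)

Section Stability.
Context {F : realFieldType} (I J K : finType).
Variables (v u : I -> J -> K -> F) (r c : J -> F) (x : I -> F) (t : J -> K -> F).
Variable e : F.
Hypothesis v0 : forall i j k, 0 <= v i j k.
Hypothesis u0 : forall i j k, 0 <= u i j k.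
Hypothesis vr : forall i j, \sum_k v i j k = r j.
Hypothesis uc : forall j k, \sum_i u i j k = c j.
Hypothesis c0 : forall j, 0 <= c j.
Hypothesis x01 : forall i, 0 <= x i <= 1.
Hypothesis t01 : forall j k, 0 <= t j k <= 1.
Hypothesis xE : forall i, `|x i - (1 + \sum_j \sum_k v i j k * t j k)^-1| <= e.
Hypothesis tE : forall j k, `|t j k - (1 + \sum_i u i j k * x i)^-1| <= e.

Let rho := \sum_j r j.
Let tau j (z : F) := (1 + c j * z)^-1.
Let s z := \sum_j r j * tau j z.

Let tv i := \sum_j \sum_k v i j k * t j k.

(* With S the sum of the block loads, both extremes of [x] almost solve
   z * (1 + S z) = 1; as z * S z is nondecreasing, the left side has slope at least 1,
   so the two extremes are close. *)
Lemma stable_fixpoint_bound i1 i2 : (forall i, x i2 <= x i <= x i1) ->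
  x i1 - x i2 <= 2 * (1 + 2 * rho) * e /\
  forall j k, tau j (x i1) - e <= t j k <= tau j (x i2) + e.
Proof.
move=> hx.
have r0 j : 0 <= r j by rewrite -(vr i1) sumr_ge0.
have rho0 : 0 <= rho by rewrite sumr_ge0.
have x0 i : 0 <= x i by have /andP[] := x01 i.
have x1 i : x i <= 1 by have /andP[] := x01 i.
have htau j k : tau j (x i1) - e <= t j k <= tau j (x i2) + e.
  have := tE j k; rewrite ler_distl => /andP[lo hi].
  have w0 : 0 <= \sum_i u i j k * x i by rewrite sumr_ge0// => i _; rewrite mulr_ge0.
  apply/andP; split.
  - apply: le_trans lo; rewrite lerD2r lef_pV2 ?posrE ?ltr_pwDl ?mulr_ge0//.
    rewrite lerD2l -(uc j k) mulr_suml; apply: ler_sum => i _.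
    by rewrite ler_wpM2l//; have /andP[] := hx i.
  - apply: (le_trans hi); rewrite lerD2r lef_pV2 ?posrE ?ltr_pwDl ?mulr_ge0//.
    rewrite lerD2l -(uc j k) mulr_suml; apply: ler_sum => i _.
    by rewrite ler_wpM2l//; have /andP[] := hx i.
split=> //.
have e0 : 0 <= e by apply: le_trans (xE i1).
have T0 i : 0 <= tv i.
  by apply: sumr_ge0 => j _; apply: sumr_ge0 => k _; rewrite mulr_ge0//; have /andP[] := t01 j k.
have Trho i : tv i <= rho.
  apply: ler_sum => j _; rewrite -(vr i); apply: ler_sum => k _.
  by rewrite ler_piMr//; have /andP[] := t01 j k.
have Tlo i : s (x i1) - rho * e <= tv i.
  rewrite /s /rho mulr_suml -sumrB; apply: ler_sum => j _.
  rewrite -mulrBr -(vr i) mulr_suml; apply: ler_sum => k _.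
  by rewrite ler_wpM2l//; have /andP[] := htau j k.
have Thi i : tv i <= s (x i2) + rho * e.
  rewrite /s /rho mulr_suml -big_split; apply: ler_sum => j _ /=.
  rewrite -mulrDr -(vr i) mulr_suml; apply: ler_sum => k _.
  by rewrite ler_wpM2l//; have /andP[] := htau j k.
(* Clearing the denominator costs at most [e * (1 + rho)], and replacing the load [tv i1] by
   [s (x i1)] costs another [rho * e]; hence [(1 + 2 * rho) * e], and likewise in [gY]. *)
have gX : x i1 * (1 + s (x i1)) <= 1 + (1 + 2 * rho) * e.
  have T1 : 0 < 1 + tv i1 by rewrite ltr_pwDl.
  have : x i1 <= (1 + tv i1)^-1 + e by have := xE i1; rewrite ler_distl => /andP[].
  rewrite -(ler_pM2r T1) mulrDl mulVf ?gt_eqF// => h.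
  have h1 := ler_wpM2l (x0 i1) (Tlo i1).
  have h2 := ler_wpM2l e0 (Trho i1).
  have h3 := ler_wpM2r (mulr_ge0 rho0 e0) (x1 i1).
  nra.
have gY : 1 - (1 + 2 * rho) * e <= x i2 * (1 + s (x i2)).
  have T1 : 0 < 1 + tv i2 by rewrite ltr_pwDl.
  have : (1 + tv i2)^-1 - e <= x i2 by have := xE i2; rewrite ler_distl => /andP[].
  rewrite -(ler_pM2r T1) mulrBl mulVf ?gt_eqF// => h.
  have h1 := ler_wpM2l (x0 i2) (Thi i2).
  have h2 := ler_wpM2l e0 (Trho i2).
  have h3 := ler_wpM2r (mulr_ge0 rho0 e0) (x1 i2).
  nra.
have smono : x i2 * s (x i2) <= x i1 * s (x i1).
  rewrite /s !mulr_sumr; apply: ler_sum => j _.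
  rewrite mulrCA [leRHS]mulrCA ler_wpM2l// /tau.
  have p i : 0 < 1 + c j * x i by rewrite ltr_pwDl ?mulr_ge0.
  rewrite ler_pdivrMr// mulrAC ler_pdivlMr//.
  have /andP[x21 _] := hx i1; nra.
nra.
Qed.

(** The arg max and arg min of [x] realize the largest gap. On nonnegative arguments [tau j] is
    [c j]-Lipschitz, since its denominators are at least 1; the errors of the two compared values of
    [t] add the 2. *)
Lemma stable_fixpoint (i0 : I) :
  (forall i i', `|x i - x i'| <= 2 * (1 + 2 * rho) * e) /\
  (forall j k k', `|t j k - t j k'| <= (c j * (2 * (1 + 2 * rho)) + 2) * e).
Proof.
pose i1 := [arg max_(i > i0) x i]%O; pose i2 := [arg min_(i < i0) x i]%O.
have hx i : x i2 <= x i <= x i1.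
  rewrite /i1 /i2; case: arg_minP => // i2' _ h2; case: arg_maxP => // i1' _ h1.
  by apply/andP; split; [exact: h2 | exact: h1].
have [hd ht] := stable_fixpoint_bound hx; split=> [i i'|j k k'].
  have /andP[a b] := hx i; have /andP[a' b'] := hx i'.
  by apply: le_trans hd; rewrite ler_norml; apply/andP; split; lra.
have /andP[a b] := ht j k; have /andP[a' b'] := ht j k'.
have x0 i : 0 <= x i by have /andP[] := x01 i.
have p i : 0 < 1 + c j * x i by rewrite ltr_pwDl ?mulr_ge0.
have htau : tau j (x i2) - tau j (x i1) <= c j * (x i1 - x i2).
  rewrite /tau; have -> : (1 + c j * x i2)^-1 - (1 + c j * x i1)^-1 =
     c j * (x i1 - x i2) / ((1 + c j * x i2) * (1 + c j * x i1)).
    by field; rewrite !gt_eqF.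
  have /andP[x21 _] := hx i1.
  rewrite ler_piMr ?mulr_ge0 ?subr_ge0// invf_le1 ?mulr_gt0//.
  by rewrite -[leLHS]mulr1 ler_pM ?ler01// lerDl mulr_ge0.
have := ler_wpM2l (c0 j) hd => hd'.
by rewrite ler_norml; apply/andP; split; lra.
Qed.

End Stability.

(** * Averages over blocks and the block equations they satisfy *)

Section BlockAverage.
Context {F : realFieldType} {I U : finType} (rho : U -> I) (N : nat).
Hypothesis N0 : (0 < N)%N.
Hypothesis fiber : forall i, #|[pred r | rho r == i]| = N.

Definition block_avg (k : U -> F) i := N%:R^-1 * \sum_(r | rho r == i) k r.

Let N1 : (N%:R : F) != 0. Proof. by rewrite pnatr_eq0 -lt0n. Qed.

Lemma sum_block (f : I -> F) (k : U -> F) :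
  \sum_r f (rho r) * k r = N%:R * \sum_i f i * block_avg k i.
Proof.
rewrite (partition_big rho xpredT)//= mulr_sumr; apply: eq_bigr => i _.
rewrite /block_avg mulrCA (mulrA N%:R) mulfV// mul1r mulr_sumr.
by apply: eq_bigr => r /eqP ->.
Qed.

Lemma block_avg_cst c i : block_avg (fun=> c) i = c.
Proof. by rewrite /block_avg sumr_const fiber -[c *+ N]mulr_natl mulrA mulVf ?mul1r. Qed.

Lemma block_avgB (k l : U -> F) i :
  block_avg (fun r => k r - l r) i = block_avg k i - block_avg l i.
Proof. by rewrite /block_avg sumrB mulrBr. Qed.

Lemma block_avg_itv (k : U -> F) i : (forall r, 0 <= k r <= 1) -> 0 <= block_avg k i <= 1.
Proof.
move=> k01; apply/andP; split.
  by rewrite mulr_ge0 ?invr_ge0// sumr_ge0// => r _; have /andP[] := k01 r.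
rewrite -[leRHS](block_avg_cst 1 i) ler_wpM2l ?invr_ge0//.
by apply: ler_sum => r _; have /andP[] := k01 r.
Qed.

Lemma block_avg_dist (k : U -> F) (f : I -> F) i :
  `|block_avg k i - f i| <= N%:R^-1 * \sum_r `|k r - f (rho r)|.
Proof.
rewrite -[f i](block_avg_cst _ i) -block_avgB normrM ger0_norm ?invr_ge0//.
rewrite ler_wpM2l ?invr_ge0//; apply: (le_trans (ler_norm_sum _ _ _)).
rewrite [leRHS](bigID (fun r => rho r == i))/=.
apply: ler_wpDr; first by apply: sumr_ge0 => r _.
by rewrite le_eqVlt; apply/orP; left; apply/eqP/eq_bigr => r /eqP ->.
Qed.

(** The zero sum is subtracted for free, so [1 - block_avg k i] becomes [ref i - block_avg k i]:
    only the deviation of the averages from [ref] is paid for. In use, [ref] is constant on each set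
    over which [f] sums to 0. *)
Lemma sum_centered_le (f ref : I -> F) (k : U -> F) (c : F) :
  \sum_i f i * (1 - ref i) = 0 -> (forall i, `|block_avg k i - ref i| <= c) ->
  \sum_r f (rho r) * (1 - k r) <= N%:R * ((\sum_i `|f i|) * c).
Proof.
move=> f0 kc; rewrite (sum_block f (fun r => 1 - k r)) ler_wpM2l//.
under eq_bigr do rewrite block_avgB block_avg_cst.
have -> : \sum_i f i * (1 - block_avg k i) = \sum_i f i * (ref i - block_avg k i).
  rewrite -[LHS]subr0 -[X in _ - X]f0 -sumrB.
  by apply: eq_bigr => i _; ring.
rewrite mulr_suml; apply: ler_sum => i _.
apply: (le_trans (ler_norm _)); rewrite normrM distrC.
by rewrite ler_wpM2l.
Qed.

End BlockAverage.

Section BlockFixpoint.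
Context {F : realFieldType} {I J K U V : finType} (rho : U -> I) (kap : V -> J * K).
Context (p1 n1 : nat) (p0 : (0 < p1)%N) (n0 : (0 < n1)%N).
Hypothesis fiber_rho : forall i, #|[pred r | rho r == i]| = p1.
Hypothesis fiber_kap : forall jk, #|[pred c | kap c == jk]| = n1.
Variables (a : I -> J -> K -> F) (vr uc : J -> F) (k : U -> F) (l : V -> F).
Hypothesis a0 : forall i j k, 0 <= a i j k.
Hypothesis avr : forall i j, \sum_k n1%:R * a i j k = vr j.
Hypothesis auc : forall j k, \sum_i p1%:R * a i j k = uc j.
Hypothesis uc0 : forall j, 0 <= uc j.
Hypothesis k01 : forall r, 0 <= k r <= 1.
Hypothesis l01 : forall c, 0 <= l c <= 1.

Definition row_gap r := k r - (1 + \sum_c a (rho r) (kap c).1 (kap c).2 * l c)^-1.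
Definition clm_gap c := l c - (1 + \sum_r a (rho r) (kap c).1 (kap c).2 * k r)^-1.
(** Dividing by the block sizes makes this dominate the residual of each block average, of either
    kind, so it can play the part of the single error [e] of [stable_fixpoint]. *)
Definition total_gap :=
  p1%:R^-1 * (\sum_r `|row_gap r|) + n1%:R^-1 * (\sum_c `|clm_gap c|).

Definition fix_const : F := 2 * (1 + 2 * \sum_j vr j).

Let x := block_avg rho p1 k.
Let t j k := block_avg kap n1 l (j, k).

(** The reciprocal in [row_gap r] depends on [r] only through its block, so averaging the entrywise
    equations over a block leaves it unchanged; regrouping the inner sum by blocks multiplies the
    weights by the block sizes. *)
Lemma block_fixpoint (i0 : I) :
  (forall i i', `|x i - x i'| <= fix_const * total_gap) /\
  (forall j k k', `|t j k - t j k'| <= (uc j * fix_const + 2) * total_gap).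
Proof.
have gx : 0 <= p1%:R^-1 * (\sum_r `|row_gap r|).
  by rewrite mulr_ge0 ?invr_ge0// sumr_ge0.
have gt : 0 <= n1%:R^-1 * (\sum_c `|clm_gap c|).
  by rewrite mulr_ge0 ?invr_ge0// sumr_ge0.
apply: (@stable_fixpoint F I J K (fun i j k => n1%:R * a i j k)
  (fun i j k => p1%:R * a i j k) vr uc x t total_gap) => //.
- by move=> i j k'; rewrite mulr_ge0.
- by move=> i j k'; rewrite mulr_ge0.
- by move=> i; exact: block_avg_itv.
- by move=> j k'; exact: block_avg_itv.
- move=> i; pose f i := (1 + \sum_c a i (kap c).1 (kap c).2 * l c)^-1.
  have -> : (1 + \sum_j \sum_k0 n1%:R * a i j k0 * t j k0)^-1 = f i.
    rewrite /f (sum_block kap n0 (fun jk => a i jk.1 jk.2) l); congr (1 + _)^-1.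
    rewrite mulr_sumr pair_bigA; apply: eq_bigr => -[j k'] _ /=.
    by rewrite mulrA.
  apply: (le_trans (block_avg_dist p0 fiber_rho k f i)).
  by rewrite lerDl.
- move=> j k'; pose f jk := (1 + \sum_r a (rho r) jk.1 jk.2 * k r)^-1.
  have -> : (1 + \sum_i p1%:R * a i j k' * x i)^-1 = f (j, k').
    rewrite /f (sum_block rho p0 (fun i => a i j k') k); congr (1 + _)^-1.
    by rewrite mulr_sumr; apply: eq_bigr => i _; rewrite mulrA.
  apply: (le_trans (block_avg_dist n0 fiber_kap l f (j, k'))).
  by rewrite lerDr.
Qed.

End BlockFixpoint.

(** * Independence and expectations *)

Section Independence.
Context {d : measure_display} {T : measurableType d} {R : realType}
  (P : probability T R) {I : choiceType} (X : I -> {RV P >-> R}).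
Hypothesis indX : mutually_independent X.

(* A pi-system generating the sigma-algebra of all the [X j] with [j != i]. *)
Definition others (i : I) : set (set T) :=
  [set E | exists (s : seq I) (A : I -> set R),
    [/\ uniq s, i \notin s, (forall j, measurable (A j)) &
        E = \bigcap_(j in [set j | j \in s]) (X j @^-1` A j)]].

Definition others_measurable i (Y : T -> R) :=
  measurable_fun setT (Y : g_sigma_algebraType (others i) -> R).

Lemma others_measurable_sub i : others i `<=` measurable.
Proof.
move=> _ [s [A [us iS mA ->]]].
apply: fin_bigcap_measurable; first exact: finite_seq.
by move=> j _; rewrite -[X in measurable X]setTI; exact: measurable_funPT.
Qed.

Lemma others_measurable_coord i j : j != i -> others_measurable i (X j).
Proof.
move=> ji _ A mA; rewrite setTI; apply: sub_gen_smallest.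
exists [:: j], (fun=> A); split => //; first by rewrite inE eq_sym.
rewrite eqEsubset; split=> [x Ax k /=|x h]; first by rewrite inE => /eqP ->.
by apply: (h j); rewrite /= inE.
Qed.

Lemma others_measurableW i Y : others_measurable i Y -> measurable_fun setT Y.
Proof.
move=> mY _ A mA; have := mY measurableT A mA.
by apply: smallest_sub; [exact: sigma_algebra_measurable|exact: others_measurable_sub].
Qed.

Lemma setI_closed_others i : setI_closed (others i).
Proof.
move=> _ _ [s [A [us iS mA ->]]] [t [B [ut it mB ->]]].
exists (undup (s ++ t)),
  (fun j => (if j \in s then A j else setT) `&` (if j \in t then B j else setT)).
split; first exact: undup_uniq.
- by rewrite mem_undup mem_cat negb_or iS.
- by move=> j; apply: measurableI; case: ifP.
rewrite eqEsubset; split=> [x [hA hB] j /=|x h].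
- by move=> _; split; case: ifP => // jk; [exact: hA|exact: hB].
- split=> j /= js; have := h j; rewrite /= mem_undup mem_cat js ?orbT => /(_ isT) [].
  + by [].
  + by [].
Qed.

(** Uniqueness of measures: as functions of [E], both sides are finite measures, and they agree on
    the pi-system [others i] by the product rule. *)
Lemma others_indep i (A : set R) E : measurable A -> <<s others i >> E ->
  P (X i @^-1` A `&` E) = (P (X i @^-1` A) * P E)%E.
Proof.
move=> mA; pose D := X i @^-1` A.
have mD : measurable D by rewrite /D -[X in measurable X]setTI; exact: measurable_funPT.
have p0 : 0 <= fine (P D) by exact: fine_ge0.
pose m1 := mrestr P mD.
pose m2 := mscale (NngNum p0) P.
have fP : (fine (P D))%:E = P D by rewrite fineK// fin_num_measure.
have m2E C : m2 C = (P D * P C)%E by rewrite -fP.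
move=> sE; rewrite -/D -fP setIC; change (m1 E = m2 E).
apply: (@g_sigma_algebra_measure_unique d R T (others i)
  (@others_measurable_sub i) (fun=> setT)) => //.
- move=> n; exists [::], (fun=> setT); split=> //; last first.
    by rewrite eqEsubset; split=> // x _ j.
- by rewrite bigcup_const//; exists 0%N.
- exact: setI_closed_others.
- move=> _ [s [B [us iS mB ->]]].
  (* [B'] places [A] at [i], so the product rule over [i :: s] splits off the factor of [X i]. *)
  pose B' j := if j == i then A else B j.
  have B's j : j \in s -> B' j = B j.
    by rewrite /B'; case: eqP => // ->; rewrite (negPf iS).
  have mB' j : measurable (B' j) by rewrite /B'; case: ifP.
  have us' : uniq (i :: s) by rewrite /= iS.
  rewrite -[LHS]/(m1 _) -[RHS]/(m2 _) m2E /m1 /mrestr.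
  have := indX us' mB'; rewrite big_cons {2}/B' eqxx.
  have -> : \bigcap_(j in [set j | j \in i :: s]) X j @^-1` B' j =
     \bigcap_(j in [set j | j \in s]) X j @^-1` B j `&` D.
    rewrite eqEsubset; split=> [x h|x [h1 h2] j /=].
    + split=> [j /= js|]; last by have := h i; rewrite /= inE eqxx /B' eqxx; apply.
      by have := h j; rewrite /= inE js orbT B's//; apply.
    + rewrite inE => /predU1P[->|js]; first by rewrite /B' eqxx.
      by rewrite B's//; exact: h1.
  move=> ->; rewrite (indX us mB); congr (_ * _)%E.
  by rewrite !big_seq; apply: eq_bigr => j js; rewrite B's.
- move=> _; change (P (setT `&` D) < +oo)%E.
  by rewrite setTI -ge0_fin_numE// fin_num_measure.
Qed.

(** By [others_indep] the law of the pair [(X i, Y)] is the product of its marginals; Tonelli on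
    absolute values gives integrability, then Fubini the product formula. *)
Lemma indep_integral i (phi : R -> R) (Y : T -> R) :
  measurable_fun setT phi -> others_measurable i Y ->
  P.-integrable setT (EFin \o (phi \o X i)) -> P.-integrable setT (EFin \o Y) ->
  P.-integrable setT (EFin \o (fun w => phi (X i w) * Y w)) /\
  \int[P]_w (phi (X i w) * Y w) = \int[P]_w phi (X i w) * \int[P]_w Y w.
Proof.
move=> mphi oY iphi iY; have mY := others_measurableW oY.
pose Y' : {RV P >-> R} := HB.pack Y (isMeasurableFun.Build _ _ _ _ _ mY).
have mXY : measurable_fun setT (fun w => (X i w, Y w)).
  by apply: measurable_fun_pair => //; exact: measurable_funPT.
pose Z : {RV P >-> (R * R)%type} := HB.pack (fun w => (X i w, Y w))
  (isMeasurableFun.Build _ _ _ _ _ mXY).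
pose m1 := distribution P (X i); pose m2 := distribution P Y'.
have mE A : measurable A -> (m1 \x m2)%E A = distribution P Z A.
  apply: product_measure_unique => {}A B mA mB.
  change (P (X i @^-1` A `&` Y @^-1` B) = P (X i @^-1` A) * P (Y @^-1` B))%E.
  apply: others_indep => //.
  by have := oY measurableT _ mB; rewrite setTI.
pose f (z : (R * R)%type) : R := phi z.1 * z.2.
have mf : measurable_fun [set: (R * R)%type] f.
  apply: measurable_funM; last exact: measurable_snd.
  by apply: measurableT_comp => //; exact: measurable_fst.
Local Open Scope ereal_scope.
have mEf : measurable_fun [set: (R * R)%type] (EFin \o f) by exact/measurable_EFinP.
have ephi : \int[m1]_x (phi x)%:E = \int[P]_w (phi (X i w))%:E.
  by rewrite integral_distribution//; exact/measurable_EFinP.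
have eY : \int[m2]_y y%:E = \int[P]_w (Y w)%:E.
  by rewrite integral_distribution//; exact/measurable_EFinP.
have eaphi : \int[m1]_x `|(phi x)%:E| = \int[P]_w `|(phi (X i w))%:E|.
  rewrite ge0_integral_distribution//.
  by apply: measurableT_comp => //; exact/measurable_EFinP.
have eaY : \int[m2]_y `|y%:E| = \int[P]_w `|(Y w)%:E|.
  rewrite ge0_integral_distribution//.
  by apply: measurableT_comp => //; exact/measurable_EFinP.
have maphi : measurable_fun setT (fun x : R => `|(phi x)%:E|).
  by apply: measurableT_comp => //; exact/measurable_EFinP.
have may : measurable_fun setT (fun y : R => `|y%:E|).
  by apply: measurableT_comp => //; exact/measurable_EFinP.
have if12 : (m1 \x m2).-integrable setT (EFin \o f).
  apply/(integrable12ltyP _ _ mEf).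
  rewrite [ltLHS](_ : _ = (\int[m1]_x `|(phi x)%:E|) * (\int[m2]_y `|y%:E|)).
    rewrite eaphi eaY lte_mul_pinfty//; first exact: integral_ge0.
    - rewrite ge0_fin_numE; last exact: integral_ge0.
      by case/integrableP: iphi.
    - by case/integrableP: iY.
  rewrite -ge0_integralZr//; last exact: integral_ge0.
  apply: eq_integral => x _; rewrite -ge0_integralZl//.
  by apply: eq_integral => y _; rewrite /= /f/= normrM EFinM.
have aZ : \int[distribution P Z]_z `|(EFin \o f) z| = \int[m1 \x m2]_z `|(EFin \o f) z|.
  by apply: eq_measure_integral => A mA _; apply/esym/mE.
have iZ : P.-integrable setT ((EFin \o f) \o Z).
  apply/integrableP; split; first exact: measurableT_comp.
  have := @ge0_integral_distribution _ _ _ _ _ P Z (fun z => `|(EFin \o f) z|).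
  move=> /(_ (measurableT_comp _ mEf)) <-//; rewrite aZ.
  by case/integrableP: if12.
split; first exact: iZ.
rewrite /Rintegral -fineM; [|exact: integrable_fin_num..].
congr fine; rewrite -(integral_distribution (X := Z) mEf iZ).
rewrite (eq_measure_integral (m1 \x m2)); last by move=> A mA _; apply/esym/mE.
rewrite -integral12_prod_meas1// /fubini_F/= -ephi -eY.
have fY : \int[m2]_y y%:E \is a fin_num by rewrite eY; exact: integrable_fin_num.
rewrite -(fineK fY) -integralZr//; last first.
  apply/integrableP; split; first exact/measurable_EFinP.
  by rewrite eaphi; case/integrableP: iphi.
apply: eq_integral => x _; rewrite (fineK fY) -integralZl//.
  by apply/integrableP; split; [exact/measurable_EFinP|rewrite eaY; case/integrableP: iY].
Qed.

End Independence.

Section Expectation.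
Context {d : measure_display} {T : measurableType d} {R : realType}
  (P : probability T R).

Definition intg (f : T -> R) := P.-integrable setT (EFin \o f).
Definition Ex (f : T -> R) : R := \int[P]_w f w.

Lemma intg_le (f g : T -> R) : measurable_fun setT f -> intg g ->
  (forall w, `|f w| <= g w) -> intg f.
Proof.
move=> mf ig fg; apply: le_integrable ig => //; first exact/measurable_EFinP.
by move=> w _ /=; rewrite lee_fin (le_trans (fg w))// ler_norm.
Qed.

Lemma intg_cst c : intg (fun=> c).
Proof. exact: finite_measure_integrable_cst. Qed.

Lemma intgD (f g : T -> R) : intg f -> intg g -> intg (fun w => f w + g w).
Proof. by move=> hf hg; apply: eq_integrable (integrableD measurableT hf hg). Qed.

Lemma intgZ (c : R) (f : T -> R) : intg f -> intg (fun w => c * f w).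
Proof. by move=> hf; apply: eq_integrable (integrableZl measurableT c hf). Qed.

Lemma intg_norm (f : T -> R) : intg f -> intg (fun w => `|f w|).
Proof. by move=> hf; apply: eq_integrable (integrable_abse hf). Qed.

Lemma intg_bounded (c : R) (f : T -> R) : measurable_fun setT f -> (forall w, `|f w| <= c) -> intg f.
Proof. by move=> mf fc; exact: intg_le mf (intg_cst c) fc. Qed.

Lemma intg_sum (J : Type) (s : seq J) (f : J -> T -> R) :
  (forall j, intg (f j)) -> intg (fun w => \sum_(j <- s) f j w).
Proof.
move=> hf; elim: s => [|j s ih].
  by under eq_fun do rewrite big_nil; exact: intg_cst.
by under eq_fun do rewrite big_cons; exact: intgD.
Qed.

Lemma ExD (f g : T -> R) : intg f -> intg g -> Ex (fun w => f w + g w) = Ex f + Ex g.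
Proof. by move=> hf hg; exact: RintegralD. Qed.

Lemma ExZ (c : R) (f : T -> R) : intg f -> Ex (fun w => c * f w) = c * Ex f.
Proof. by move=> hf; exact: RintegralZl. Qed.

Lemma Ex_cst c : Ex (fun=> c) = c.
Proof. by rewrite /Ex (Rintegral_cst P measurableT) [X in fine X](@probability_setT _ _ _ P) mulr1. Qed.

Lemma Ex_ge0 (f : T -> R) : (forall w, 0 <= f w) -> 0 <= Ex f.
Proof. by move=> f0; apply: Rintegral_ge0 => w _. Qed.

Lemma Ex_le (f g : T -> R) : intg f -> intg g -> (forall w, f w <= g w) -> Ex f <= Ex g.
Proof. by move=> hf hg fg; apply: le_Rintegral => // w _. Qed.

Lemma Ex_sum (J : Type) (s : seq J) (f : J -> T -> R) :
  (forall j, intg (f j)) ->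
  Ex (fun w => \sum_(j <- s) f j w) = \sum_(j <- s) Ex (f j).
Proof.
move=> hf; elim: s => [|j s ih].
  by under [in LHS]eq_fun do rewrite big_nil; rewrite Ex_cst big_nil.
under [in LHS]eq_fun do rewrite big_cons.
by rewrite ExD ?ih ?big_cons//; exact: intg_sum.
Qed.

Lemma Ex_le_cst (c : R) (f : T -> R) : measurable_fun setT f -> (forall w, 0 <= f w <= c) -> Ex f <= c.
Proof.
move=> mf fc; rewrite -[leRHS]Ex_cst; apply: Ex_le; last by move=> w; have /andP[] := fc w.
- by apply: (@intg_bounded c) => // w; have /andP[f0 fc'] := fc w; rewrite ger0_norm.
- exact: intg_cst.
Qed.

End Expectation.

(** * Variance of quadratic forms in independent variables *)

Section QuadraticForm.
Context {d : measure_display} {T : measurableType d} {R : realType}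
  (P : probability T R) {I : choiceType} (X : I -> {RV P >-> R}).
Hypothesis indX : mutually_independent X.
Local Notation intg := (intg P).
Local Notation Ex := (Ex P).
Variables (tau M : R).
Hypothesis tau0 : 0 <= tau.
Hypothesis X4 : forall i, intg (fun w => X i w ^+ 4).
Hypothesis X1 : forall i, Ex (X i) = 0.
Hypothesis X2 : forall i, Ex (fun w => X i w ^+ 2) = tau.
Hypothesis XM : forall i, Ex (fun w => (X i w ^+ 2 - tau) ^+ 2) <= M.
Hypothesis tauM : tau ^+ 2 <= M.

Variables (K : finType) (phi : K -> I).
Hypothesis phiI : injective phi.
Variables (q : K -> K -> T -> R) (C : R).
Hypothesis qC : forall a b w, `|q a b w| <= C.
Hypothesis qm : forall a b c, others_measurable X (phi c) (q a b).

Let g a := X (phi a).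
Let mg a : measurable_fun setT (g a : T -> R). Proof. exact: measurable_funPT. Qed.
(** Centred product: it has mean zero for [a = b] as well as for [a != b]. The deviation of the
    quadratic form from its mean part is the sum of the weighted products [Z a b]. *)
Let p a b w := g a w * g b w - (if a == b then tau else 0).
Let Z a b w := q a b w * p a b w.
(* Integrable envelope for the products of two factors [p] or [g]. *)
Let U w := \sum_a g a w ^+ 4 + (2 * tau ^+ 2 + 1).

Let mq a b : measurable_fun setT (q a b).
Proof. exact: others_measurableW (@qm a b a). Qed.

Let mp a b : measurable_fun setT (p a b).
Proof. by apply: measurable_funB => //; exact: measurable_funM. Qed.

Let mZ a b : measurable_fun setT (Z a b). Proof. exact: measurable_funM. Qed.

Let iU : intg U.
Proof. by apply: intgD (intg_cst _ _); apply: intg_sum => a; exact: X4. Qed.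

Let g4U a w : g a w ^+ 4 <= U w.
Proof.
rewrite /U (bigD1 a)//= -addrA lerDl addr_ge0//.
  by apply: sumr_ge0 => b _; rewrite (exprM _ 2 2) sqr_ge0.
by rewrite addr_ge0// mulr_ge0// sqr_ge0.
Qed.

Let U1 w : 1 <= U w.
Proof.
rewrite /U addrA lerDr addr_ge0 ?mulr_ge0 ?sqr_ge0//.
by apply: sumr_ge0 => b _; rewrite (exprM _ 2 2) sqr_ge0.
Qed.

Let g2U a w : g a w ^+ 2 <= U w.
Proof.
have h4 := g4U a w; have u1 := U1 w.
have := sqr_ge0 (g a w ^+ 2 - 1); nra.
Qed.

Let pU a b w : p a b w ^+ 2 <= 4 * U w.
Proof.
have ta : tau ^+ 2 <= U w.
  rewrite /U addrA; apply: le_trans (_ : 2 * tau ^+ 2 <= _).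
    by rewrite ler_peMl ?sqr_ge0// ler1n.
  rewrite -addrA addrCA lerDl addr_ge0//.
  by apply: sumr_ge0 => c _; rewrite (exprM _ 2 2) sqr_ge0.
have ga := g4U a w; have gb := g4U b w; have u1 := U1 w.
have c2 : (if a == b then tau else 0) ^+ 2 <= U w.
  by case: ifP => // _; rewrite expr0n; apply: le_trans u1; exact: ler01.
rewrite /p; move: (if _ then _ else _) c2 => c c2.
have h1 := sqr_ge0 (g a w ^+ 2 - g b w ^+ 2).
have h2 := sqr_ge0 (g a w * g b w + c); nra.
Qed.

Let iqp x y a b c e z :
  intg (fun w => q x y w * q a b w * (p c e w * g z w)) /\
  intg (fun w => q x y w * Z a b w) /\ intg (fun w => Z a b w * Z c e w).
Proof.
have bnd w u : `|u| <= 4 * U w -> `|q x y w * q a b w * u| <= C ^+ 2 * 4 * U w.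
  by move=> hz; rewrite normrM -mulrA ler_pM// normrM expr2 ler_pM.
have am (u v : R) : `|u * v| <= (u ^+ 2 + v ^+ 2) / 2.
  have := sqr_ge0 (u - v); have := sqr_ge0 (u + v) => h1 h2.
  by rewrite ler_norml; apply/andP; split; lra.
have iCU k : intg (fun w => k * U w) by exact: intgZ.
split; [|split].
- apply: (@intg_le _ _ _ _ _ (fun w => (C ^+ 2 * 4) * U w)) => //.
    by do 2 apply: measurable_funM => //.
  move=> w; apply: bnd; apply: (le_trans (am _ _)).
  by have := pU c e w; have := g2U z w; have := U1 w; lra.
- apply: (@intg_le _ _ _ _ _ (fun w => (C ^+ 2 * 4) * U w)) => //.
    exact: measurable_funM.
  move=> w; rewrite /Z mulrA; apply: bnd; rewrite -[p _ _ _]mulr1.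
  apply: (le_trans (am _ _)).
  by have := pU a b w; have := U1 w; lra.
- apply: (@intg_le _ _ _ _ _ (fun w => (C ^+ 2 * 4) * U w)) => //.
    exact: measurable_funM.
  move=> w; rewrite /Z mulrACA normrM -mulrA; apply: ler_pM => //.
    by rewrite normrM expr2 ler_pM.
  by apply: (le_trans (am _ _)); have := pU a b w; have := pU c e w; lra.
Qed.

Let iZZ a b c e : intg (fun w => Z a b w * Z c e w).
Proof. by have [_ []] := iqp a a a b c e a. Qed.

Let iq2 a b : intg (fun w => q a b w ^+ 2).
Proof.
apply: (@intg_bounded _ _ _ P (C ^+ 2)); first exact: measurable_funX.
by move=> w; rewrite normrX lerXn2r// nnegrE (le_trans _ (qC a b w)).
Qed.

Let ig a : intg (g a).
Proof.
apply: (@intg_le _ _ _ _ _ (fun w => U w)) => // w.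
have h := sqr_ge0 (g a w - 1); have h' := sqr_ge0 (g a w + 1).
have := g2U a w; have := U1 w.
by rewrite ler_norml => h1 h2; apply/andP; split; lra.
Qed.

Let ip a b : intg (p a b).
Proof.
apply: (@intg_le _ _ _ _ _ (fun w => 5 * U w)) => //; first exact: intgZ.
move=> w; have h := sqr_ge0 (p a b w - 1); have h' := sqr_ge0 (p a b w + 1).
have := pU a b w; have := U1 w.
by rewrite ler_norml => h1 h2; apply/andP; split; lra.
Qed.

Let ip2 a b : intg (fun w => p a b w ^+ 2).
Proof.
apply: (@intg_le _ _ _ _ _ (fun w => 4 * U w)) => //; first exact: measurable_funX.
  exact: intgZ.
by move=> w; rewrite ger0_norm ?sqr_ge0.
Qed.

Let og x a : x != a -> others_measurable X (phi x) (g a).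
Proof. by move=> xa; apply: others_measurable_coord; rewrite (inj_eq phiI) eq_sym. Qed.

Let osq x f : others_measurable X (phi x) f ->
  others_measurable X (phi x) (fun w => f w ^+ 2).
Proof. by move=> mf; apply: measurable_funX. Qed.

Let oZ x a b : x != a -> x != b -> others_measurable X (phi x) (Z a b).
Proof.
move=> xa xb; apply: measurable_funM; first exact: qm.
by apply: measurable_funB => //; apply: measurable_funM; exact: og.
Qed.

Let indepE x (f : R -> R) (Y : T -> R) : measurable_fun setT f ->
  others_measurable X (phi x) Y -> intg (fun w => f (g x w)) -> intg Y ->
  Ex (fun w => f (g x w) * Y w) = Ex (fun w => f (g x w)) * Ex Y.
Proof. by move=> mf oY fi iY; have [] := indep_integral indX mf oY fi iY. Qed.

Let pxx x w : p x x w = g x w ^+ 2 - tau. Proof. by rewrite /p eqxx. Qed.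

Let msq : measurable_fun setT (fun y : R => y ^+ 2).
Proof. exact: measurable_funX. Qed.

Let msqB : measurable_fun setT (fun y : R => y ^+ 2 - tau).
Proof. exact: measurable_funB. Qed.

Let ig2 x : intg (fun w => g x w ^+ 2).
Proof.
have := intgD (ip x x) (intg_cst P tau); apply: eq_integrable => // w _ /=.
by rewrite pxx subrK.
Qed.

(** The variable at [x] occurs in one centred factor only; everything else is measurable for the
    remaining variables. A single variable is integrated out, which is why [qm] excludes one
    coordinate at a time. *)
Let lone_square x c e : x != c -> x != e -> Ex (fun w => Z x x w * Z c e w) = 0.
Proof.
move=> xc xe; transitivity (Ex (fun w => (g x w ^+ 2 - tau) * (q x x w * Z c e w))).
  by congr (Ex _); apply/funext => w; rewrite {1}/Z pxx; ring.
rewrite (@indepE x _ _ msqB).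
- rewrite (ExD (ig2 x) (intg_cst P (- tau))) Ex_cst X2 subrr mul0r//.
- by apply: measurable_funM; [exact: qm|exact: oZ].
- by apply: eq_integrable (ip x x) => // w _ /=; rewrite pxx.
- by have [_ []] := iqp x x c e c e x.
Qed.

Let lone_linear x b r s c e : x != b -> x != c -> x != e ->
  Ex (fun w => g x w * (q r s w * g b w * Z c e w)) = 0.
Proof.
move=> xb xc xe; rewrite (@indepE x id) ?X1 ?mul0r//.
- apply: measurable_funM; last exact: oZ.
  by apply: measurable_funM; [exact: qm|exact: og].
- have [h _] := iqp r s c e c e b; move: h; apply: eq_integrable => // w _ /=.
  by rewrite /Z; congr EFin; ring.
Qed.

Let Zneq a b w : a != b -> Z a b w = q a b w * (g a w * g b w).
Proof. by move=> /negPf ab; rewrite /Z /p ab subr0. Qed.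

Let lone_left a b c e : a != c -> a != e -> Ex (fun w => Z a b w * Z c e w) = 0.
Proof.
move=> ac ae; have [<-|ab] := eqVneq a b; first exact: lone_square.
rewrite -[RHS](@lone_linear a b a b c e)//.
by congr (Ex _); apply/funext => w; rewrite Zneq//; ring.
Qed.

Let lone_right a b c e : b != c -> b != e -> Ex (fun w => Z a b w * Z c e w) = 0.
Proof.
move=> bc be; have [->|ab] := eqVneq a b; first exact: lone_square.
rewrite -[RHS](@lone_linear b a a b c e)// 1?eq_sym//.
by congr (Ex _); apply/funext => w; rewrite Zneq//; ring.
Qed.

Let ZC a b c e : Ex (fun w => Z a b w * Z c e w) = Ex (fun w => Z c e w * Z a b w).
Proof. by congr (Ex _); apply/funext => w; rewrite mulrC. Qed.

(* Some index occurs in only one of the two factors, and [Z] is centered in it. *)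
Let cross a b c e : (c, e) != (a, b) -> (c, e) != (b, a) ->
  Ex (fun w => Z a b w * Z c e w) = 0.
Proof.
rewrite !xpair_eqE => h1 h2.
have [ac|ac] := eqVneq a c; have [ae|ae] := eqVneq a e; last exact: lone_left.
- have ba : b != a by move: h1; rewrite -ac -ae eqxx /= eq_sym.
  by apply: lone_right; rewrite -?ac -?ae.
- have be : b != e by move: h1; rewrite -ac eqxx /= eq_sym.
  by rewrite ZC; apply: lone_right; rewrite eq_sym.
- have bc : b != c by move: h2; rewrite -ae eqxx andbT eq_sym.
  by rewrite ZC; apply: lone_left; rewrite eq_sym.
Qed.

(** For [a = b] the factor is the variance of a square, bounded through [XM]; for [a != b] the two
    variables are integrated out in turn and leave [tau ^+ 2], bounded through [tauM]. *)
Let diag a b : Ex (fun w => Z a b w * Z a b w) <= M * Ex (fun w => q a b w ^+ 2).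
Proof.
have oq x : others_measurable X (phi x) (fun w => q a b w ^+ 2).
  by apply: measurable_funX; exact: qm.
have q0 : 0 <= Ex (fun w => q a b w ^+ 2) by apply: Ex_ge0 => w; exact: sqr_ge0.
have [ab|ab] := eqVneq a b.
  rewrite [leLHS](_ : _ = Ex (fun w => (g a w ^+ 2 - tau) ^+ 2 * q a b w ^+ 2)); last first.
    by congr (Ex _); apply/funext => w; rewrite /Z /p ab eqxx; ring.
  rewrite (@indepE a (fun y => (y ^+ 2 - tau) ^+ 2))//.
  - by apply: ler_wpM2r => //; exact: XM.
  - exact: measurable_funX.
  - by apply: eq_integrable (ip2 a a) => // w _ /=; rewrite pxx.
rewrite [leLHS](_ : _ = Ex (fun w => g a w ^+ 2 * (g b w ^+ 2 * q a b w ^+ 2))); last first.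
  by congr (Ex _); apply/funext => w; rewrite Zneq//; ring.
have [ib ->] : intg (fun w => g b w ^+ 2 * q a b w ^+ 2) /\
    Ex (fun w => g a w ^+ 2 * (g b w ^+ 2 * q a b w ^+ 2)) =
    tau ^+ 2 * Ex (fun w => q a b w ^+ 2).
  have [ib _] := indep_integral indX msq (@oq b) (ig2 b) (iq2 a b).
  split=> //; rewrite (@indepE a (fun y => y ^+ 2))//.
  - by rewrite (@indepE b (fun y => y ^+ 2))// !X2 mulrA expr2.
  - by apply: measurable_funM; [exact: (@osq a (g b) (@og a b ab))|exact: (@oq a)].
by rewrite ler_wpM2r.
Qed.

Let ZZ (s : K * K) := Z s.1 s.2.
Let dev w := \sum_a \sum_b q a b w * (g a w * g b w) - tau * \sum_a q a a w.

Let dev_sq w : dev w ^+ 2 = \sum_s \sum_t ZZ s w * ZZ t w.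
Proof.
have -> : dev w = \sum_s ZZ s w.
  rewrite -(pair_bigA _ (fun a b => Z a b w))/= /dev mulr_sumr -sumrB.
  apply: eq_bigr => a _; rewrite (bigD1 a)//= [RHS](bigD1 a)//= addrAC; congr (_ + _).
    by rewrite /Z pxx; ring.
  by apply: eq_bigr => b ba; rewrite Zneq// eq_sym.
by rewrite expr2 mulr_suml; apply: eq_bigr => s _; rewrite mulr_sumr.
Qed.

Let iS s : intg (fun w => \sum_t ZZ s w * ZZ t w).
Proof. by apply: intg_sum => t; exact: iZZ. Qed.

Let idev_sq : intg (fun w => dev w ^+ 2).
Proof. by under eq_fun do rewrite dev_sq; exact: intg_sum. Qed.

Let mdev : measurable_fun setT dev.
Proof.
apply: measurable_funB; last by apply: measurable_funM => //; exact: measurable_sum.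
apply: measurable_sum => a; apply: measurable_sum => b.
by apply: measurable_funM => //; exact: measurable_funM.
Qed.

(** In the expanded square, the pair [s] correlates only with itself and with its transpose. The
    first term is at most [v s]; the second, by 2xy <= x^2 + y^2, at most the mean of [v s] and
    [v (s.2, s.1)]. Summing over [s] doubles the total of the [v s]. *)
Lemma quadratic_form_variance :
  Ex (fun w => (\sum_a \sum_b q a b w * (X (phi a) w * X (phi b) w)
    - tau * \sum_a q a a w) ^+ 2) <= 2 * M * \sum_a \sum_b Ex (fun w => q a b w ^+ 2).
Proof.
pose v (s : K * K) := M * Ex (fun w => q s.1 s.2 w ^+ 2).
have v0 s : 0 <= v s.
  rewrite mulr_ge0 ?Ex_ge0// => [|w]; last exact: sqr_ge0.
  exact: le_trans (sqr_ge0 tau) tauM.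
rewrite [leLHS](_ : _ = Ex (fun w => \sum_s \sum_t ZZ s w * ZZ t w)); last first.
  by congr (Ex _); apply/funext => w; exact: dev_sq.
rewrite Ex_sum//.
apply: (@le_trans _ _ (\sum_s (v s + (v s + v (s.2, s.1)) / 2))).
  apply: ler_sum => s _; rewrite Ex_sum//; last by move=> t; exact: iZZ.
  rewrite (bigD1 s)//= addrC [leRHS]addrC.
  have h r t : Ex (fun w => ZZ r w * ZZ t w) <= (v r + v t) / 2.
    have dr := diag r.1 r.2; have dt := diag t.1 t.2.
    apply: (@le_trans _ _ (2^-1 * Ex (fun w => ZZ r w * ZZ r w + ZZ t w * ZZ t w))).
      rewrite -ExZ; last by apply: intgD; exact: iZZ.
      apply: Ex_le; [exact: iZZ|by apply/intgZ/intgD; exact: iZZ|move=> w].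
      by have := sqr_ge0 (ZZ r w - ZZ t w); lra.
    rewrite ExD; [|exact: iZZ..].
    by rewrite mulrC ler_wpM2r ?invr_ge0// lerD.
  rewrite lerD ?diag//; have [ss|ss] := eqVneq (s.2, s.1) s.
    rewrite big1 ?divr_ge0 ?addr_ge0// => t ts.
    by apply: cross; rewrite -?surjective_pairing// ss.
  rewrite (bigD1 (s.2, s.1))//= big1 ?addr0 ?h// => t /andP[ts ts'].
  by apply: cross; rewrite -?surjective_pairing.
rewrite big_split/= -mulr_suml big_split/=.
have -> : \sum_(s : K * K) v (s.2, s.1) = \sum_s v s.
  by rewrite [RHS](reindex_inj (h := fun s : K * K => (s.2, s.1)))// => -[? ?] [? ?] [-> ->].
rewrite le_eqVlt; apply/orP; left; apply/eqP.
have -> : \sum_s v s = M * \sum_a \sum_b Ex (fun w => q a b w ^+ 2).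
  by rewrite /v -mulr_sumr (pair_bigA _ (fun a b => Ex (fun w => q a b w ^+ 2))).
by field.
Qed.

(** From |x| <= eps + x^2 / eps. Leaving [eps] free replaces the square root of Cauchy-Schwarz and
    keeps the bound linear in the variance. *)
Lemma quadratic_form_L1 (D eps : R) :
  (forall w, \sum_a \sum_b q a b w ^+ 2 <= D) -> 0 < eps ->
  let dev w := \sum_a \sum_b q a b w * (X (phi a) w * X (phi b) w)
    - tau * \sum_a q a a w in
  intg dev /\ Ex (fun w => `|dev w|) <= eps + 2 * M * D / eps.
Proof.
move=> qD e0; change (intg dev /\ Ex (fun w => `|dev w|) <= eps + 2 * M * D / eps).
have bnd w : `|dev w| <= eps + eps^-1 * dev w ^+ 2.
  rewrite -(ler_pM2l e0) mulrDr mulrA mulfV ?gt_eqF// mul1r -(real_normK (num_real (dev w))).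
  by have := sqr_ge0 (`|dev w| - eps / 2); have := sqr_ge0 eps; nra.
have ib : intg (fun w => eps + eps^-1 * dev w ^+ 2).
  by apply: intgD; [exact: intg_cst|exact: intgZ].
have idev : intg dev by exact: intg_le bnd.
split=> //; apply: (@le_trans _ _ (Ex (fun w => eps + eps^-1 * dev w ^+ 2))).
  by apply: Ex_le => //; exact: intg_norm.
rewrite ExD ?ExZ ?Ex_cst//; [|exact: intg_cst|exact: intgZ].
rewrite lerD2l mulrC; apply: ler_wpM2r; first by rewrite invr_ge0 ltW.
have M0 : 0 <= M by exact: le_trans (sqr_ge0 tau) tauM.
apply: (le_trans quadratic_form_variance); rewrite ler_wpM2l ?mulr_ge0//.
have -> : \sum_a \sum_b Ex (fun w => q a b w ^+ 2) =
    Ex (fun w => \sum_a \sum_b q a b w ^+ 2).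
  rewrite Ex_sum; last by move=> a; exact: intg_sum.
  by apply: eq_bigr => a _; rewrite Ex_sum.
apply: Ex_le_cst.
  apply: measurable_sum => a; apply: measurable_sum => b; exact: measurable_funX.
move=> w; rewrite qD andbT; apply: sumr_ge0 => a _; apply: sumr_ge0 => b _.
exact: sqr_ge0.
Qed.

End QuadraticForm.

(** * Moments of the real Gaussian entries *)

Section NormalMoments.
Context {R : realType}.
Local Notation mu := (@lebesgue_measure R).
Local Notation s := (Num.sqrt (2^-1 : R)).
Local Notation nu := (normal_prob (0 : R) s).

Lemma normal_integral (f : R -> \bar R) : measurable_fun setT f ->
  (forall x, 0 <= f x)%E ->
  (\int[nu]_x f x = \int[mu]_x (f x * (normal_pdf 0 s x)%:E))%E.
Proof.
move=> mf f0; have dom := @normal_prob_dominates R 0 s.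
rewrite -(Radon_Nikodym_SigmaFinite.change_of_variables dom f0 measurableT mf).
apply: ae_eq_integral => //.
- apply: emeasurable_funM => //.
  exact: measurable_int (Radon_Nikodym_SigmaFinite.f_integrable dom).
- by apply: emeasurable_funM => //; apply/measurable_EFinP; exact: measurable_normal_pdf.
- apply: ae_eqe_mul2l; apply: integral_ae_eq => //.
  + exact: Radon_Nikodym_SigmaFinite.f_integrable.
  + by apply/measurable_EFinP; exact: measurable_normal_pdf.
  + by move=> A _ mA; rewrite -Radon_Nikodym_SigmaFinite.f_integral.
Qed.

(** Variance 1/2 makes the Gaussian factor exp(-x^2). With y = x^2/2 the claim is 4 y^2 exp(-2y) <=
    16 exp(-y), that is (y/2)^2 <= exp y. The fourth moment is thus dominated by the total mass of a
    standard normal law. *)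
Lemma pow4_normal_fun (x : R) : x ^+ 4 * normal_fun 0 s x <= 16 * normal_fun 0 1 x.
Proof.
rewrite /normal_fun subr0 sqr_sqrtr ?invr_ge0// -mulr_natr mulVf ?pnatr_eq0// divr1.
rewrite expr1n; set y := x ^+ 2 / 2.
have -> : - x ^+ 2 / (1 *+ 2) = - y by rewrite /y; field.
have -> : - x ^+ 2 = - y - y by rewrite /y; field.
have y0 : 0 <= y by rewrite divr_ge0 ?sqr_ge0.
have -> : x ^+ 4 = 4 * y ^+ 2 by rewrite /y; field.
rewrite expRD mulrA ler_wpM2r ?expR_ge0// expRN ler_pdivrMr ?expR_gt0//.
have h : y / 2 <= expR (y / 2) by apply: le_trans (expR_ge1Dx _); rewrite lerDr ler01.
have -> : expR y = expR (y / 2) ^+ 2 by rewrite expr2 -expRD; congr expR; field.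
have : (y / 2) ^+ 2 <= expR (y / 2) ^+ 2.
  by apply: lerXn2r => //; rewrite nnegrE ?expR_ge0// divr_ge0.
by rewrite expr_div_n; lra.
Qed.

Lemma normal_pow4_integrable : nu.-integrable setT (fun x : R => (x ^+ 4)%:E).
Proof.
have m4 : measurable_fun setT (fun x : R => (x ^+ 4)%:E).
  by apply/measurable_EFinP; exact: measurable_funX.
have x4 (x : R) : 0 <= x ^+ 4 by rewrite (exprM _ 2 2) sqr_ge0.
have p0 : 0 < normal_peak (1 : R) by rewrite normal_peak_gt0// oner_eq0.
pose c := 16 * normal_peak s / normal_peak 1.
have c0 : 0 <= c by rewrite divr_ge0 ?mulr_ge0 ?normal_peak_ge0.
apply/integrableP; split=> //.
under eq_integral do rewrite gee0_abs ?lee_fin//.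
rewrite (normal_integral m4 (fun x => x4 x)).
apply: (@le_lt_trans _ _ (\int[mu]_x (c%:E * (normal_pdf 0 1 x)%:E))%E).
  apply: ge0_le_integral => //.
  - by move=> x _; rewrite mule_ge0 ?lee_fin ?normal_pdf_ge0.
  - by apply: emeasurable_funM => //; apply/measurable_EFinP; exact: measurable_normal_pdf.
  - by apply: emeasurable_funM => //; apply/measurable_EFinP; exact: measurable_normal_pdf.
  - move=> x _; rewrite -!EFinM lee_fin !normal_pdfE ?oner_eq0//.
    rewrite [leRHS](_ : _ = normal_peak s * (16 * normal_fun 0 1 x)).
      by rewrite mulrCA ler_wpM2l ?normal_peak_ge0// pow4_normal_fun.
    by rewrite /c; field; rewrite gt_eqF.
rewrite ge0_integralZl//.
- by rewrite integral_normal_pdf mule1 ltry.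
- by apply/measurable_EFinP; exact: measurable_normal_pdf.
- by move=> x _; rewrite lee_fin normal_pdf_ge0.
Qed.

Lemma normal_integral_opp (f : R -> \bar R) : measurable_fun setT f ->
  (forall x, 0 <= f x)%E -> (\int[nu]_x f (- x)%R = \int[nu]_x f x)%E.
Proof.
move=> mf f0.
have mN : measurable_fun setT (-%R : R -> R) by exact: oppr_measurable.
rewrite !normal_integral//; last exact: measurableT_comp.
pose h x := (f x * (normal_pdf 0 s x)%:E)%E.
transitivity (\int[mu]_x h (- x)%R)%E.
  apply: eq_integral => x _; rewrite /h !normal_pdfE// /normal_fun.
  by rewrite !subr0 sqrrN.
have mh : measurable_fun setT h.
  by apply: emeasurable_funM => //; apply/measurable_EFinP; exact: measurable_normal_pdf.
have h0 x : (0 <= h x)%E by rewrite mule_ge0// lee_fin normal_pdf_ge0.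
rewrite -[LHS]/(\int[mu]_(x in (-%R : _ -> measurableTypeR R) @^-1` setT) (h \o -%R) x)%E.
rewrite -ge0_integral_pushforward//=.
by apply: eq_measure_integral => //= A mA _; exact: lebesgue_measureN.
Qed.

Lemma normal_integrable_pow4 (f : R -> R) (c : R) : measurable_fun setT f ->
  (forall x, `|f x| <= c * (x ^+ 4 + 1)) -> nu.-integrable setT (EFin \o f).
Proof.
move=> mf fc; apply: (@intg_le _ _ _ nu f (fun x => c * (x ^+ 4 + 1))) => //.
by apply: intgZ; apply: intgD; [exact: normal_pow4_integrable|exact: intg_cst].
Qed.

(** Reflection invariance gives the positive and negative parts the same integral, and domination by
    x^4 + 1 makes it finite. *)
Lemma normal_mean : (\int[nu]_x x%:E = 0)%E.
Proof.
have ix : nu.-integrable setT (EFin \o (fun x : R => x)).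
  apply: (@normal_integrable_pow4 _ 1) => // x; rewrite mul1r ler_norml.
  have h1 := sqr_ge0 (x ^+ 2 - 2^-1); have h2 := sqr_ge0 (x - 2^-1).
  have h3 := sqr_ge0 (x + 2^-1).
  have -> : x ^+ 4 = (x ^+ 2) ^+ 2 by rewrite -exprM.
  by apply/andP; split; nra.
rewrite integralE.
have -> : (\int[nu]_x ((fun x => x%:E)^\- x) = \int[nu]_x ((fun x => x%:E)^\+ x))%E.
  rewrite -[RHS]normal_integral_opp//; last first.
    by apply: measurable_funepos; exact/measurable_EFinP.
  by apply: eq_integral => x _; rewrite funeposE funenegE EFinN.
by rewrite subee//; exact/integrable_fin_num/integrable_funepos.
Qed.

(** Variance of one real coordinate, carried as a symbol; [2 * normal_var] is then the mean squared
    modulus of a complex entry. *)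
Definition normal_var : R := Ex nu (fun x => x ^+ 2).

(** A sum of two nonnegative terms, so that one constant meets both requirements on [M] in the
    quadratic form bounds. *)
Definition normal_bound : R :=
  normal_var ^+ 2 + Ex nu (fun x => (x ^+ 2 - normal_var) ^+ 2).

Lemma normal_var_ge0 : 0 <= normal_var.
Proof. by apply: Ex_ge0 => x; exact: sqr_ge0. Qed.

Lemma normal_var_bound : normal_var ^+ 2 <= normal_bound.
Proof. by rewrite lerDl; apply: Ex_ge0 => x; exact: sqr_ge0. Qed.

Section Transfer.
Context {d : measure_display} {T : measurableType d} (P : probability T R)
  (X : {RV P >-> R}).
Hypothesis hX : forall A : set R, measurable A -> distribution P X A = nu A.

Lemma normal_transfer (f : R -> R) (c : R) : measurable_fun setT f ->
  (forall x, `|f x| <= c * (x ^+ 4 + 1)) ->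
  intg P (fun w => f (X w)) /\ Ex P (fun w => f (X w)) = Ex nu f.
Proof.
move=> mf fc; have iN := normal_integrable_pow4 mf fc.
have mid : measurable_fun setT (id : measurableTypeR R -> R) by exact: measurable_id.
(* [nu] lives on [measurableTypeR R], whose display differs from that of [R]. *)
pose J : {RV nu >-> R} := HB.pack (id : measurableTypeR R -> R)
  (isMeasurableFun.Build _ _ (measurableTypeR R) R _ mid).
have hJ A : measurable A -> distribution P X A = distribution nu J A by exact: hX.
have mEf : measurable_fun setT (EFin \o f) by exact/measurable_EFinP.
have mA : measurable_fun setT (fun x => `|(EFin \o f) x|%E) by exact: measurableT_comp.
have iX : P.-integrable setT ((EFin \o f) \o X).
  apply/integrableP; split; first exact: measurableT_comp.
  have eX := ge0_integral_distribution X mA (fun=> abse_ge0 _).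
  have eJ := ge0_integral_distribution J mA (fun=> abse_ge0 _).
  rewrite -[ltLHS]eX (eq_measure_integral (distribution nu J)); last first.
    by move=> A ? _; exact: hJ.
  by rewrite eJ; case/integrableP: iN.
split; first exact: iX.
rewrite /Ex /Rintegral; congr fine; rewrite -(integral_distribution mEf iX).
rewrite -(@integral_distribution _ _ _ _ _ nu J _ mEf iN).
by apply: eq_measure_integral => A ? _; exact: hJ.
Qed.

Let pow4 (x : R) : x ^+ 4 = (x ^+ 2) ^+ 2. Proof. by rewrite -exprM. Qed.

Lemma normal_RV4 : intg P (fun w => X w ^+ 4).
Proof.
have [] // := @normal_transfer (fun x => x ^+ 4) 1 (measurable_funX 4 (@measurable_id _ _ setT)).
by move=> x; rewrite mul1r ger0_norm ?lerDl// pow4 sqr_ge0.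
Qed.

Lemma normal_RV1 : Ex P X = 0.
Proof.
have [|_ ->] := @normal_transfer id 1 (@measurable_id _ _ setT).
  move=> x; rewrite mul1r ler_norml pow4.
  have h1 := sqr_ge0 (x ^+ 2 - 2^-1); have h2 := sqr_ge0 (x - 2^-1).
  have h3 := sqr_ge0 (x + 2^-1).
  by apply/andP; split; nra.
by rewrite /Ex /Rintegral normal_mean.
Qed.

Let normal_sq : intg P (fun w => X w ^+ 2) /\ Ex P (fun w => X w ^+ 2) = normal_var.
Proof.
apply: (@normal_transfer (fun x => x ^+ 2) 1 (measurable_funX 2 (@measurable_id _ _ setT))).
move=> x; rewrite mul1r ger0_norm ?sqr_ge0// pow4.
by have := sqr_ge0 (x ^+ 2 - 1); nra.
Qed.

Lemma normal_RV2_intg : intg P (fun w => X w ^+ 2). Proof. by case: normal_sq. Qed.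

Lemma normal_RV2 : Ex P (fun w => X w ^+ 2) = normal_var. Proof. by case: normal_sq. Qed.

Lemma normal_RVM : Ex P (fun w => (X w ^+ 2 - normal_var) ^+ 2) <= normal_bound.
Proof.
have [||_ ->] := @normal_transfer (fun x => (x ^+ 2 - normal_var) ^+ 2)
  (2 + 2 * normal_var ^+ 2).
- by apply: measurable_funX; apply: measurable_funB => //; exact: measurable_funX.
- move=> x; rewrite ger0_norm ?sqr_ge0// pow4; move: normal_var => v.
  by have := sqr_ge0 (x ^+ 2 + v); have := sqr_ge0 (x ^+ 2); have := sqr_ge0 (x ^+ 2 * v); nra.
- by rewrite /normal_bound lerDr sqr_ge0.
Qed.

End Transfer.
End NormalMoments.

(** * Resolvents and log-determinants *)

Local Notation "A ^H" := (map_mx Num.conj A^T) (at level 8, format "A ^H") : ring_scope.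
Local Open Scope complex_scope.

Section PositiveSemidefinite.
Context {C : numClosedFieldType}.

Lemma adjM m n k (A : 'M[C]_(m, n)) (B : 'M[C]_(n, k)) :
  (A *m B)^H = B^H *m A^H.
Proof. by rewrite trmx_mul map_mxM. Qed.

Lemma adj1 n : (1%:M : 'M[C]_n)^H = 1%:M.
Proof. by rewrite trmx1 map_mx1. Qed.

Lemma adj_inv n (A : 'M[C]_n) : (invmx A)^H = invmx (A^H).
Proof. by rewrite trmx_inv map_invmx. Qed.

Lemma adj_diag n (d : 'rV[C]_n) : (diag_mx d)^H = diag_mx (map_mx Num.conj d).
Proof. by rewrite tr_diag_mx map_diag_mx. Qed.

(** Positivity encoded by a Gram factorization: sums become block concatenation, congruences become
    products, and Hermitian symmetry comes with it. *)
Definition psd n (A : 'M[C]_n) := exists k (Z : 'M[C]_(n, k)), A = Z *m Z^H.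

Lemma psd_gram n k (Z : 'M[C]_(n, k)) : psd (Z *m Z^H).
Proof. by exists k, Z. Qed.

Lemma psd_adj n (A : 'M[C]_n) : psd A -> A^H = A.
Proof. by move=> [k [Z ->]]; rewrite adjM trmxCK. Qed.

Lemma psdD n (A B : 'M[C]_n) : psd A -> psd B -> psd (A + B).
Proof.
move=> [k [Z ->]] [l [Y ->]]; exists (k + l)%N, (row_mx Z Y).
by rewrite tr_row_mx map_col_mx mul_row_col.
Qed.

Lemma psd_congr m n (X : 'M[C]_(m, n)) (A : 'M[C]_n) :
  psd A -> psd (X *m A *m X^H).
Proof. by move=> [k [Z ->]]; exists k, (X *m Z); rewrite adjM !mulmxA. Qed.

Lemma psd1 n : psd (1%:M : 'M[C]_n).
Proof. by exists n, 1%:M; rewrite adj1 mulmx1. Qed.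

Lemma psd_diagmx n (d : 'rV[C]_n) : (forall i, 0 <= d 0 i) -> psd (diag_mx d).
Proof.
move=> d0; exists n, (diag_mx (map_mx sqrtC d)).
rewrite adj_diag mulmx_diag; congr diag_mx; apply/rowP => i; rewrite !mxE.
by rewrite geC0_conj ?sqrtC_ge0// -expr2 sqrtCK.
Qed.

Lemma psd_diag_ge0 n (A : 'M[C]_n) i : psd A -> 0 <= A i i.
Proof.
move=> [k [Z ->]]; rewrite mxE sumr_ge0// => j _.
by rewrite !mxE mul_conjC_ge0.
Qed.

Lemma psd_tr_ge0 n (A : 'M[C]_n) : psd A -> 0 <= \tr A.
Proof. by move=> pA; rewrite sumr_ge0// => i _; exact: psd_diag_ge0. Qed.

Lemma psd_tr_mul_ge0 n (A B : 'M[C]_n) : psd A -> psd B -> 0 <= \tr (A *m B).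
Proof.
move=> pA [l [Y ->]]; rewrite mulmxA mxtrace_mulC.
by rewrite -{2}[Y]trmxCK mulmxA; apply: psd_tr_ge0; exact: psd_congr.
Qed.

Lemma psd_inv n (A : 'M[C]_n) : psd A -> A \in unitmx -> psd (invmx A).
Proof.
move=> pA uA; have -> : invmx A = invmx A *m A *m (invmx A)^H.
  by rewrite adj_inv psd_adj// mulVmx// mul1mx.
exact: psd_congr.
Qed.

(** A row [v] of the kernel satisfies v v^H + (v Z)(v Z)^H = 0, a sum of two nonnegative numbers, so
    v = 0. *)
Lemma psd_add1_unit n (A : 'M[C]_n) : psd A -> 1%:M + A \in unitmx.
Proof.
move=> [k [Z ->]]; rewrite -row_free_unit -kermx_eq0; apply/eqP/row_matrixP => i.
rewrite row0; set v := row i _.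
have : v *m (1%:M + Z *m Z^H) = 0 by rewrite /v -row_mul mulmx_ker row0.
move=> /(congr1 (fun x => (x *m v^H) 0 0)); rewrite mul0mx mulmxDr mulmx1 mulmxDl.
rewrite mulmxA -(mulmxA (v *m Z)) -adjM [RHS]mxE mxE => /eqP.
rewrite paddr_eq0; [|exact: psd_diag_ge0 (psd_gram _)..].
rewrite mxE psumr_eq0; last by move=> j _; rewrite !mxE mul_conjC_ge0.
move=> /andP[/allP v0 _]; apply/rowP => j; apply/eqP.
by have := v0 j (mem_index_enum _); rewrite !mxE/= mul_conjC_eq0.
Qed.

Lemma psd_spectral n (A : 'M[C]_n) : psd A -> exists2 U : 'M[C]_n, U \is unitarymx &
  exists2 e : 'rV_n, (forall i, 0 <= e 0 i) & A = U^H *m diag_mx e *m U.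
Proof.
move=> pA; have : A \is normalmx by apply/normalmxP; rewrite psd_adj.
move=> /orthomx_spectralP AE; have uU := spectral_unitarymx A.
rewrite invmx_unitary// in AE; move: (spectralmx A) (spectral_diag A) uU AE.
move=> U e uU AE; exists U => //; exists e => // i.
have : diag_mx e = U *m A *m U^H.
  by rewrite AE !mulmxA mulmxtVK// (unitarymxP uU) mul1mx.
move=> /matrixP/(_ i i); rewrite mxE eqxx mulr1n => ->.
exact/psd_diag_ge0/psd_congr.
Qed.

End PositiveSemidefinite.

(** Sylvester's identity: two triangular factorizations of the same block matrix. *)
Lemma det_add1_mulC (K : comUnitRingType) m n (A : 'M[K]_(m, n)) (B : 'M[K]_(n, m)) :
  \det (1%:M + A *m B) = \det (1%:M + B *m A).
Proof.
have e1 : block_mx 1%:M (- A) B 1%:M =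
   block_mx 1%:M 0 B 1%:M *m block_mx 1%:M (- A) 0 (1%:M + B *m A).
  rewrite mulmx_block ?mulmx1 ?mul1mx ?mul0mx ?mulmx0 ?addr0 mulmxN.
  by rewrite addrCA addNr addr0.
have e2 : block_mx 1%:M (- A) B 1%:M =
   block_mx 1%:M (- A) 0 1%:M *m block_mx (1%:M + A *m B) 0 B 1%:M.
  rewrite mulmx_block ?mulmx1 ?mul1mx ?mul0mx ?mulmx0 ?add0r mulNmx.
  by rewrite addrK.
have := congr1 determinant e1; rewrite e2 !det_mulmx !det_ublock !det_lblock.
by rewrite !det1 !mul1r !mulr1.
Qed.

Section Resolvent.
Context {C : numClosedFieldType}.

Definition rsv m n (G : 'M[C]_(m, n)) : 'M[C]_m := invmx (1%:M + G *m G^H).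

Section Identities.
Context m n (G : 'M[C]_(m, n)).
Local Notation S := (G *m G^H).
Local Notation K := (rsv G).

Lemma rsv_unit : 1%:M + S \in unitmx.
Proof. exact/psd_add1_unit/psd_gram. Qed.

Lemma rsvV : K *m (1%:M + S) = 1%:M.
Proof. exact: mulVmx rsv_unit. Qed.

Lemma rsvVr : (1%:M + S) *m K = 1%:M.
Proof. exact: mulmxV rsv_unit. Qed.

Lemma psd_rsv : psd K.
Proof. by apply: psd_inv rsv_unit; apply: psdD (psd1 _) (psd_gram _). Qed.

Lemma gram_mul_rsv : S *m K = 1%:M - K.
Proof. by apply/eqP; rewrite eq_sym subr_eq addrC -{1}[K]mul1mx -mulmxDl rsvVr. Qed.

(** This is K = K (1 + S) K, split along the sum. Dropping the second Gram term bounds the squared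
    norm of a row of [K] by its diagonal entry. *)
Lemma rsv_sqE : K = K *m K^H + (K *m G) *m (K *m G)^H.
Proof.
by rewrite adjM !mulmxA -(mulmxA K G) -mulmxDl -{2}[K]mulmx1 -mulmxDr rsvV mul1mx psd_adj//;
   exact: psd_rsv.
Qed.

Lemma rsv_row_le i : \sum_j `|K i j| ^+ 2 <= K i i.
Proof.
have /matrixP/(_ i i) -> := rsv_sqE; rewrite mxE mxE.
rewrite [leLHS](_ : _ = \sum_j K i j * K^H j i).
  by rewrite lerDl; apply: psd_diag_ge0; exact: psd_gram.
by apply: eq_bigr => j _; rewrite !mxE normCK.
Qed.

Lemma rsv_ge0 i : 0 <= K i i. Proof. exact: psd_diag_ge0 psd_rsv. Qed.

Lemma rsv_le1 i : K i i <= 1.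
Proof.
have [->|K0] := eqVneq (K i i) 0; first exact: ler01.
have : K i i ^+ 2 <= K i i.
  apply: le_trans (rsv_row_le i); rewrite (bigD1 i)//= ger0_norm ?rsv_ge0//.
  by rewrite lerDl sumr_ge0// => j _; rewrite exprn_ge0.
by rewrite expr2 -{3}[K i i]mulr1 ler_pM2l// lt_def K0 rsv_ge0.
Qed.

Lemma rsv_row_le1 i : \sum_j `|K i j| ^+ 2 <= 1.
Proof. exact: le_trans (rsv_row_le i) (rsv_le1 i). Qed.

(** Push-through identity, from G (1 + G^H G) = (1 + G G^H) G; it carries diagonals of the
    antenna-side resolvent to the user side. *)
Lemma rsv_push : G^H *m K *m G = 1%:M - rsv (G^H).
Proof.
have uV := psd_add1_unit (psd_gram (G^H)).
have e : G *m (1%:M + G^H *m G^H^H) = (1%:M + S) *m G.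
  by rewrite trmxCK mulmxDr mulmxDl mulmx1 mul1mx mulmxA.
apply: (can_inj (mulmxK uV)).
rewrite mulmxBl mul1mx [X in _ - X]mulVmx// -(mulmxA _ G) e mulmxA.
by rewrite -(mulmxA _ K) rsvV mulmx1 trmxCK addrC addKr.
Qed.

End Identities.
End Resolvent.

(** * Eigenvalues, and concavity of log det *)

Section Determinants.
Context {C : numClosedFieldType}.

Lemma psd_eigen n (A : 'M[C]_n) : psd A -> A \in unitmx ->
  exists e : 'I_n -> C,
    [/\ forall i, 0 < e i, \det A = \prod_i e i & \tr A = \sum_i e i].
Proof.
move=> pA uA; have [U uU [e e0 AE]] := psd_spectral pA.
have uU1 : U \in unitmx by exact: unitarymx_unit.
rewrite -invmx_unitary// in AE.
have dA : \det A = \prod_i e 0 i.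
  by rewrite AE !det_mulmx det_inv mulrAC mulVr ?mul1r ?det_diag.
exists (e 0); split => //.
- move=> i; rewrite lt_def e0 andbT; move: uA; rewrite unitmxE dA unitfE.
  by rewrite prodf_seq_neq0 => /allP/(_ i (mem_index_enum _)).
- by rewrite AE mxtrace_mulC mulmxA mulmxV// mul1mx mxtrace_diag.
Qed.

Lemma psd_det_gt0 n (A : 'M[C]_n) : psd A -> A \in unitmx -> 0 < \det A.
Proof. by move=> pA /(psd_eigen pA)[e [e0 -> _]]; rewrite prodr_gt0. Qed.

(** B^-1 A need not be Hermitian. Writing B^-1 = D D^H, the positive matrix D^H A D has the same
    determinant and trace, and its eigenvalues are used. *)
Lemma psd_ratio_eigen n (A B : 'M[C]_n) :
  psd A -> A \in unitmx -> psd B -> B \in unitmx ->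
  exists e : 'I_n -> C, [/\ forall i, 0 < e i,
    \det A = \det B * \prod_i e i & \tr (invmx B *m A) = \sum_i e i].
Proof.
move=> pA uA pB uB; have [U uU [e e0 BE]] := psd_spectral (psd_inv pB uB).
have [D DE] : exists D : 'M[C]_n, invmx B = D *m D^H.
  exists (U^H *m diag_mx (map_mx sqrtC e)); rewrite adjM trmxCK adj_diag -mulmxA (mulmxA (diag_mx _)) mulmx_diag BE !mulmxA.
  congr (_ *m diag_mx _ *m _); apply/rowP => i; rewrite !mxE.
  by rewrite geC0_conj ?sqrtC_ge0// -expr2 sqrtCK.
have uD : D \in unitmx.
  have : invmx B \in unitmx by rewrite unitmx_inv.
  by rewrite DE unitmx_mul => /andP[].
have pX : psd (D^H *m A *m D) by rewrite -{2}[D]trmxCK; exact: psd_congr.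
have uDH : D^H \in unitmx by rewrite map_unitmx unitmx_tr.
have uX : D^H *m A *m D \in unitmx by rewrite !unitmx_mul uDH uA uD.
have [f [f0 df tf]] := psd_eigen pX uX; exists f; split => //.
- rewrite -df; have -> : \det (D^H *m A *m D) = \det (invmx B) * \det A.
    by rewrite DE !det_mulmx; ring.
  by rewrite det_inv mulVKr// -unitmxE.
- by rewrite DE -tf [RHS]mxtrace_mulC mulmxA.
Qed.

Lemma tr_power_diff m n (G : 'M[C]_(m, n)) (k : 'I_n -> C) :
  \tr (rsv G *m (1%:M + G *m diag_mx (\row_j (1 + k j)) *m G^H)) =
  m%:R + \sum_j k j * (1 - rsv (G^H) j j).
Proof.
have -> : 1%:M + G *m diag_mx (\row_j (1 + k j)) *m G^H =
   (1%:M + G *m G^H) + G *m diag_mx (\row_j k j) *m G^H.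
  have -> : diag_mx (\row_j (1 + k j)) = 1%:M + diag_mx (\row_j k j).
    by apply/matrixP => i j; rewrite !mxE -mulrnDl.
  by rewrite mulmxDr mulmx1 mulmxDl addrA.
rewrite mulmxDr rsvV linearD/= mxtrace1; congr (_ + _).
rewrite !mulmxA mxtrace_mulC !mulmxA rsv_push.
by apply: eq_bigr => j _; rewrite mul_mx_diag; move: (rsv _) => M; rewrite !mxE eqxx mulrC.
Qed.

End Determinants.

Section RealParts.
Context {R : realType}.
Local Notation C := R[i].
Local Notation Re := complex.Re.

Lemma ReD (x y : C) : Re (x + y) = Re x + Re y.
Proof. by case: x y => [a b] [c d]. Qed.

Lemma ReB (x y : C) : Re (x - y) = Re x - Re y.
Proof. by case: x y => [a b] [c d]. Qed.

Lemma Re_sum (I : Type) (r : seq I) (P : pred I) (F : I -> C) :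
  Re (\sum_(i <- r | P i) F i) = \sum_(i <- r | P i) Re (F i).
Proof. by elim/big_rec2: _ => // i x y _ <-; rewrite ReD. Qed.

Lemma Re_realM (a : R) (x : C) : Re (a%:C * x) = a * Re x.
Proof. by case: x => [b c] /=; rewrite mul0r subr0. Qed.

Lemma Re_nat n : Re (n%:R : C) = n%:R.
Proof. by rewrite -(rmorph_nat (@real_complex_def R (Phant R))). Qed.

Lemma ge0_ReE (x : C) : 0 <= x -> x = (Re x)%:C.
Proof. by case: x => [a b]; rewrite lecE /= => /andP[/eqP -> _]. Qed.

Lemma Re_ge0 (x : C) : 0 <= x -> 0 <= Re x.
Proof. by rewrite lecE => /andP[]. Qed.

Lemma Re_le (x y : C) : x <= y -> Re x <= Re y.
Proof. by rewrite lecE => /andP[]. Qed.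

Lemma ln_le_sub1 (x : R) : 0 < x -> ln x <= x - 1.
Proof. by move=> x0; rewrite -{1}(subrKC 1 x) le_ln1Dx// ltrBDl subrr. Qed.

Lemma ln_prod_le (n : nat) (e : 'I_n -> C) : (forall i, 0 < e i) ->
  0 < \prod_i e i /\ ln (Re (\prod_i e i)) <= Re (\sum_i e i) - n%:R.
Proof.
move=> e0; split; first by rewrite prodr_gt0.
have r0 i : 0 < Re (e i) by rewrite -ltcR -ge0_ReE// ltW.
rewrite (eq_bigr (fun i => (Re (e i))%:C)); last by move=> i _; apply/ge0_ReE/ltW.
rewrite -(rmorph_prod (real_complex R)) /= Re_sum.
have -> : n%:R = \sum_(i < n) 1 :> R by rewrite sumr_const card_ord.
rewrite -sumrB.
suff [] : 0 < \prod_i Re (e i) /\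
   ln (\prod_i Re (e i)) <= \sum_(i < n) (Re (e i) - 1) by [].
elim/big_rec2: _ => [|i x y _ [x0 h]]; first by rewrite ln1.
by rewrite mulr_gt0// lnM ?posrE// lerD// ln_le_sub1.
Qed.

Lemma ln_ReM (x y : C) : 0 < x -> 0 < y -> ln (Re (x * y)) = ln (Re x) + ln (Re y).
Proof.
move=> x0 y0; rewrite {1}(ge0_ReE (ltW x0)) Re_realM lnM// posrE -ltcR -ge0_ReE// ltW//.
Qed.

(** The tangent to the concave function log det at [B], obtained from ln e <= e - 1 for each
    eigenvalue of B^-1 A. *)
Lemma ln_det_sub n (A B : 'M[C]_n) :
  psd A -> A \in unitmx -> psd B -> B \in unitmx ->
  ln (Re (\det A)) - ln (Re (\det B)) <= Re (\tr (invmx B *m A)) - n%:R.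
Proof.
move=> pA uA pB uB; have [e [e0 -> ->]] := psd_ratio_eigen pA uA pB uB.
have [p0 h] := ln_prod_le e0.
by rewrite ln_ReM// ?psd_det_gt0// addrAC subrr add0r.
Qed.

Lemma Re_rsv_itv m n (G : 'M[C]_(m, n)) i : 0 <= Re (rsv G i i) <= 1.
Proof.
by rewrite Re_ge0 ?rsv_ge0//= -[leRHS]/(Re 1); apply: Re_le; exact: rsv_le1.
Qed.

Lemma ln_det_power m n (G : 'M[C]_(m, n)) (k : 'I_n -> R) :
  (forall j, 0 <= 1 + k j) ->
  ln (Re (\det (1%:M + G *m diag_mx (\row_j (1 + (k j)%:C)) *m G^H))) <=
  ln (Re (\det (1%:M + G *m G^H))) + \sum_j k j * (1 - Re (rsv (G^H) j j)).
Proof.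
move=> k0.
have pS : psd (G *m diag_mx (\row_j (1 + (k j)%:C)) *m G^H).
  apply/psd_congr/psd_diagmx => i; rewrite mxE.
  by rewrite -(rmorph1 (real_complex R)) -rmorphD /= ler0c.
have := ln_det_sub (psdD (psd1 _) pS) (psd_add1_unit pS)
  (psdD (psd1 _) (psd_gram G)) (rsv_unit G).
rewrite lerBlDl => /le_trans; apply; rewrite lerD2l -/(rsv G) tr_power_diff.
rewrite ReD Re_nat addrAC subrr add0r Re_sum.
by apply: ler_sum => j _; rewrite Re_realM ReB.
Qed.

End RealParts.

(** * Tangent inequality in the noise levels *)

Section NoiseTangent.
Context {C : numClosedFieldType} (m n : nat) (G : 'M[C]_(m, n)) (lam : 'I_m -> C).
Hypothesis lam0 : forall i, 0 < lam i.

Let Ls := diag_mx (\row_i (sqrtC (lam i))^-1).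
Local Notation Lam := (diag_mx (\row_i lam i)).
Local Notation S := (G *m G^H).

Definition whiten := Ls *m G.

Let LsH : Ls^H = Ls.
Proof.
rewrite adj_diag; congr diag_mx; apply/rowP => i; rewrite !mxE.
by rewrite geC0_conj// invr_ge0 sqrtC_ge0 ltW.
Qed.

Let Ls2 : Ls *m Ls = diag_mx (\row_i (lam i)^-1).
Proof.
rewrite mulmx_diag; congr diag_mx; apply/rowP => i; rewrite !mxE.
by rewrite -invfM -expr2 sqrtCK.
Qed.

Let LsLam : Ls *m Lam *m Ls = 1%:M.
Proof.
apply/matrixP => i j; rewrite mul_mx_diag mxE mul_mx_diag !mxE.
have [->|_] := eqVneq; last by rewrite mulr0n !mul0r.
have n0 : sqrtC (lam j) != 0 by rewrite sqrtC_eq0 gt_eqF.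
by rewrite !mulr1n -{2}[lam j]sqrtCK expr2 mulKf// mulfV.
Qed.

(** This is (Lam + S)^-1, expressed through the whitened resolvent so that its positivity is a
    congruence. *)
Let L := Ls *m rsv whiten *m Ls.

Let L_psd : psd L.
Proof. by rewrite /L -{2}LsH; apply/psd_congr/psd_rsv. Qed.

Let LML : L *m (Lam + S) = 1%:M.
Proof.
have e : Ls *m (Lam + S) *m Ls = 1%:M + whiten *m whiten^H.
  by rewrite mulmxDr mulmxDl LsLam /whiten adjM LsH !mulmxA.
have u : Ls \in unitmx by have [] := mulmx1_unit LsLam.
apply: (can_inj (mulmxK u)); rewrite mul1mx /L -!mulmxA (mulmxA Ls (Lam + S)) e.
by rewrite rsvV mulmx1.
Qed.

Let MLL : (Lam + S) *m L = 1%:M. Proof. exact: mulmx1C LML. Qed.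

(** Push-through turns S K into G (1 + G^H G)^-1 G^H. *)
Lemma psd_cogram_rsv : psd (S *m rsv G).
Proof.
have := rsv_push (G^H); rewrite trmxCK gram_mul_rsv => <-.
by rewrite -{2}(trmxCK G); apply/psd_congr/psd_rsv.
Qed.

(* With L := (Lam + S)^-1 and D := Lam - 1, the left side is n + tr (D S L), and
   tr (D S (K - L)) = tr (D (S K) D L) >= 0 because S K and L are positive. *)
Lemma tr_whiten_le : \tr (rsv (whiten^H) *m (1%:M + G^H *m G)) <=
  n%:R + \sum_i (lam i - 1) * (1 - rsv G i i).
Proof.
pose D := diag_mx (\row_i (lam i - 1)).
have DE : D = (Lam + S) - (1%:M + S).
  rewrite opprD addrACA subrr addr0; apply/matrixP => i j; rewrite !mxE.
  by rewrite -mulrnBl.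
have DH : D^H = D.
  rewrite adj_diag; congr diag_mx; apply/rowP => i; rewrite !mxE.
  by rewrite rmorphB rmorph1; congr (_ - _); exact/geC0_conj/ltW.
have EE : rsv (whiten^H) = 1%:M - G^H *m L *m G.
  have -> : G^H *m L *m G = whiten^H *m rsv whiten *m whiten.
    by rewrite /whiten adjM LsH !mulmxA.
  by rewrite rsv_push opprB addrC subrK.
have -> : \tr (rsv (whiten^H) *m (1%:M + G^H *m G)) = n%:R + \tr (L *m D *m S).
  rewrite EE mulmxBl mul1mx linearB/= linearD/= mxtrace1 -addrA; congr (_ + _).
  rewrite DE mulmxBr LML mulmxBl mul1mx linearB/=; congr (_ - _).
    by rewrite mxtrace_mulC.
  rewrite -(mulmxA _ G) (_ : G *m _ = (1%:M + S) *m G); last first.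
    by rewrite mulmxDr mulmxDl mul1mx mulmx1 mulmxA.
  by rewrite -mulmxA mxtrace_mulC !mulmxA.
rewrite lerD2l.
have -> : \sum_i (lam i - 1) * (1 - rsv G i i) = \tr (D *m (S *m rsv G)).
  rewrite gram_mul_rsv; apply: eq_bigr => i _; rewrite mul_diag_mx.
  by move: (rsv _) => M; rewrite !mxE eqxx.
have -> : \tr (L *m D *m S) = \tr (D *m (S *m L)).
  by rewrite -mulmxA mxtrace_mulC mulmxA.
rewrite -subr_ge0 -linearB/= -mulmxBr -mulmxBr.
have -> : rsv G - L = rsv G *m D *m L.
  by rewrite DE mulmxBr mulmxBl rsvV mul1mx -mulmxA MLL mulmx1.
have -> : D *m (S *m (rsv G *m D *m L)) = D *m (S *m rsv G) *m D^H *m L.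
  by rewrite DH !mulmxA.
exact/psd_tr_mul_ge0/L_psd/psd_congr/psd_cogram_rsv.
Qed.

Lemma det_whiten :
  \det (1%:M + whiten^H *m (whiten^H)^H) =
  \det (1%:M + diag_mx (\row_i (lam i)^-1) *m S).
Proof.
rewrite trmxCK /whiten adjM LsH !mulmxA -(mulmxA (G^H)) Ls2.
by rewrite -[in RHS]mulmxA [in RHS]mulmxA [RHS]det_add1_mulC mulmxA.
Qed.

Lemma tr_whiten : \tr (whiten^H *m (whiten^H)^H) = \sum_i (lam i)^-1 * S i i.
Proof.
rewrite trmxCK mxtrace_mulC /whiten adjM LsH !mulmxA mxtrace_mulC !mulmxA Ls2.
by apply: eq_bigr => i _; rewrite -mulmxA mul_diag_mx mxE mxE.
Qed.

End NoiseTangent.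

(** * Effect of removing one column on the resolvents *)

Section ColumnRemoval.
Context {C : numClosedFieldType} (m n : nat) (G : 'M[C]_(m, n)) (c : 'I_n).

(** Zeroing the column gives the same Gram matrix as deleting it and keeps the dimensions. *)
Definition col_zero := \matrix_(i, j) if j == c then 0 else G i j.

Local Notation G' := col_zero.
Local Notation K' := (rsv col_zero).
Local Notation h := (col c G).

Definition qform := (h^H *m K' *m h) 0 0.

Lemma gram_col_zero : G *m G^H = G' *m G'^H + h *m h^H.
Proof.
apply/matrixP => i j; rewrite !mxE (bigD1 c)//= big_ord1 addrC.
rewrite [in RHS](bigD1 c)//= !mxE eqxx mul0r add0r; congr (_ + _).
by apply: eq_bigr => k kc; rewrite !mxE (negPf kc).
Qed.

Lemma qform_ge0 : 0 <= qform.
Proof.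
by rewrite /qform -{2}[h]trmxCK; apply/psd_diag_ge0/psd_congr/psd_rsv.
Qed.

Let q1 : 1 + qform != 0.
Proof. by rewrite gt_eqF// ltr_pwDl// qform_ge0. Qed.

(** Sherman-Morrison for the rank-one update h h^H, applied to [h] itself. *)
Lemma mul_rsv_col : rsv G *m h = (1 + qform)^-1 *: (K' *m h).
Proof.
have e : (1%:M + G *m G^H) *m (K' *m h) = (1 + qform) *: h.
  rewrite gram_col_zero addrA mulmxDl mulmxA rsvVr mul1mx.
  rewrite scalerDl scale1r; congr (_ + _).
  have -> : h *m h^H *m (K' *m h) = h *m (h^H *m K' *m h) by rewrite !mulmxA.
  by rewrite [h^H *m K' *m h]mx11_scalar mul_mx_scalar.
have -> : K' *m h = (1 + qform) *: (rsv G *m h).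
  by rewrite scalemxAr -e (mulmxA (rsv G)) rsvV mul1mx.
by rewrite scalerA mulVf// scale1r.
Qed.

(** Column [c] enters this entry only as the vector of a quadratic form whose matrix ignores it;
    concentration of quadratic forms applies through this formula. *)
Lemma rsv_diag_qform : rsv (G^H) c c = (1 + qform)^-1.
Proof.
have : (h^H *m rsv G *m h) 0 0 = 1 - rsv (G^H) c c.
  have -> : h^H *m rsv G *m h = row c (G^H *m rsv G) *m col c G.
    by rewrite row_mul; congr (_ *m _ *m _); apply/rowP => i; rewrite !mxE.
  have -> : (row c (G^H *m rsv G) *m col c G) 0 0 = (G^H *m rsv G *m G) c c.
    by rewrite !mxE; apply: eq_bigr => j _; rewrite 2!mxE; congr (_ * _); rewrite mxE.
  by rewrite rsv_push; move: (rsv _) => M; rewrite !mxE eqxx.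
rewrite -mulmxA mul_rsv_col -scalemxAr mxE mulmxA -/qform => /eqP.
move=> e; rewrite -[LHS](subKr 1) -(eqP e).
by field; exact: q1.
Qed.

Lemma rsv_col_zero_diff i :
  K' i i - rsv G i i = `|(K' *m h) i 0| ^+ 2 / (1 + qform).
Proof.
have -> : K' i i - rsv G i i = (rsv G *m (h *m h^H) *m K') i i.
  have -> : rsv G *m (h *m h^H) *m K' = K' - rsv G.
    have -> : h *m h^H = (1%:M + G *m G^H) - (1%:M + G' *m G'^H).
      by rewrite gram_col_zero opprD addrACA subrr add0r addrAC subrr add0r.
    by rewrite mulmxBr mulmxBl rsvV mul1mx -mulmxA rsvVr mulmx1.
  by move: (rsv G) (rsv G') => M M'; rewrite !mxE.
rewrite mulmxA mul_rsv_col -mulmxA mxE big_ord1 -{2}[K']psd_adj; last exact: psd_rsv.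
by rewrite -adjM; move: (K' *m h) qform => v q; rewrite !mxE normCK -mulrA mulrC.
Qed.

Lemma rsv_col_zero_diff_ge0 i : 0 <= K' i i - rsv G i i.
Proof.
by rewrite rsv_col_zero_diff divr_ge0 ?exprn_ge0// addr_ge0// qform_ge0.
Qed.

(** The sum is |K' h|^2 / (1 + q) with q = h^H K' h, and |K' h|^2 <= q because K' dominates K' K'^H
    by [rsv_sqE]. *)
Lemma rsv_col_zero_diff_sum : \sum_i (K' i i - rsv G i i) <= 1.
Proof.
under eq_bigr do rewrite rsv_col_zero_diff.
have q0 : 0 < 1 + qform by rewrite ltr_pwDl// qform_ge0.
rewrite -mulr_suml ler_pdivrMr// mul1r.
apply: (@le_trans _ _ qform); last by rewrite lerDr.
have -> : qform = (h^H *m (K' *m K'^H) *m h) 0 0 +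
    (h^H *m (K' *m G' *m (K' *m G')^H) *m h) 0 0.
  by rewrite /qform {1}rsv_sqE mulmxDr mulmxDl mxE.
have -> : \sum_i `|(K' *m h) i 0| ^+ 2 = (h^H *m (K' *m K'^H) *m h) 0 0.
  have -> : h^H *m (K' *m K'^H) *m h = (K' *m h)^H *m (K' *m h).
    by rewrite adjM (psd_adj (psd_rsv _)) !mulmxA.
  move: (K' *m h) => v; rewrite mxE.
  by apply: eq_bigr => j _; rewrite !mxE normCKC.
rewrite lerDl -{2}[h]trmxCK; apply/psd_diag_ge0/psd_congr/psd_gram.
Qed.

End ColumnRemoval.

Lemma rsv_conj {C : numClosedFieldType} m n (G : 'M[C]_(m, n)) :
  rsv (map_mx Num.conj G) = map_mx Num.conj (rsv G).
Proof. by rewrite /rsv map_invmx map_mxD map_mx1 map_mxM map_trmx. Qed.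

(** The plain transpose, unlike the adjoint, is again an array of the given Gaussian variables
    without sign changes; the conjugation it introduces is invisible on the real diagonal. *)
Lemma rsv_tr {C : numClosedFieldType} m n (G : 'M[C]_(m, n)) :
  rsv G^T = map_mx Num.conj (rsv G^H).
Proof.
rewrite -rsv_conj; congr (rsv _).
by apply/matrixP => i j; rewrite !mxE conjCK.
Qed.

Lemma rsv_trH {C : numClosedFieldType} m n (G : 'M[C]_(m, n)) :
  rsv (G^T)^H = map_mx Num.conj (rsv G).
Proof. by rewrite trmxK rsv_conj. Qed.

Section NoiseGeneric.
Context {C : numClosedFieldType} (m n : nat) (G : 'M[C]_(m, n)) (lam : 'I_m -> C).
Hypothesis lam0 : forall i, 0 < lam i.
Local Notation S := (G *m G^H).
Local Notation N := (1%:M + diag_mx (\row_i (lam i)^-1) *m S).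
Local Notation Y := ((whiten G lam)^H).

Let pY := psdD (psd1 _) (psd_gram Y).

Lemma noise_det_gt0 : 0 < \det N.
Proof. by rewrite -det_whiten// psd_det_gt0// rsv_unit. Qed.

(** Lam^-1 S is not Hermitian in general, so the comparison is made on the user side: Sylvester
    turns the two determinants into those of 1 + G^H G and 1 + G^H Lam^-1 G. *)
Lemma noise_ratio_eigen : exists e : 'I_n -> C, [/\ forall i, 0 < e i,
  \det (1%:M + S) = \det N * \prod_i e i &
  \sum_i e i <= n%:R + \sum_i (lam i - 1) * (1 - rsv G i i)].
Proof.
have [e [e0 dE tE]] := psd_ratio_eigen (psdD (psd1 _) (psd_gram G^H))
  (rsv_unit G^H) pY (rsv_unit Y).
exists e; split=> //.
- by rewrite -(det_whiten G lam0) -dE trmxCK det_add1_mulC.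
- by rewrite -tE trmxCK tr_whiten_le.
Qed.

(** Comparison with the identity, giving a log-determinant at least 0; with the trace bound drawn
    from [noise_eigen] it yields integrability. *)
Lemma noise_inv_eigen : exists e : 'I_n -> C, [/\ forall i, 0 < e i,
  1 = \det N * \prod_i e i & \sum_i e i <= n%:R].
Proof.
have [e [e0 dE tE]] := psd_ratio_eigen (psd1 _) (unitmx1 _ _) pY (rsv_unit Y).
exists e; split=> //; first by rewrite -(det_whiten G lam0) -dE det1.
rewrite -tE mulmx1 -[n in leRHS]card_ord -sumr_const.
by apply: ler_sum => i _; exact: rsv_le1.
Qed.

Lemma noise_eigen : exists e : 'I_n -> C, [/\ forall i, 0 < e i,
  \det N = \prod_i e i & \sum_i e i = n%:R + \sum_i (lam i)^-1 * S i i].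
Proof.
have [e [e0 dE tE]] := psd_eigen pY (rsv_unit Y).
exists e; split=> //; first by rewrite -dE det_whiten.
by rewrite -tE linearD/= mxtrace1 tr_whiten.
Qed.

End NoiseGeneric.

Section RealBounds.
Context {R : realType}.
Local Notation C := R[i].
Local Notation Re := complex.Re.
Local Notation Im := complex.Im.

Lemma Re_conj (x : C) : Re (Num.conj x) = Re x. Proof. by case: x. Qed.

Lemma Re_rsv_tr m n (G : 'M[C]_(m, n)) j : Re (rsv G^T j j) = Re (rsv G^H j j).
Proof. by rewrite rsv_tr mxE Re_conj. Qed.

Lemma Re_rsv_trH m n (G : 'M[C]_(m, n)) i : Re (rsv (G^T)^H i i) = Re (rsv G i i).
Proof. by rewrite rsv_trH mxE Re_conj. Qed.

Section Noise.
Context m n (G : 'M[C]_(m, n)) (lam : 'I_m -> R).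
Hypothesis lam0 : forall i, 0 < lam i.

Let lamC0 i : 0 < (lam i)%:C. Proof. by rewrite ltcR. Qed.

Lemma ln_det_noise :
  ln (Re (\det (1%:M + G *m G^H))) <=
  ln (Re (\det (1%:M + diag_mx (\row_i ((lam i)%:C)^-1) *m (G *m G^H)))) +
  \sum_i (lam i - 1) * (1 - Re (rsv G i i)).
Proof.
have [e [e0 -> h]] := noise_ratio_eigen G lamC0.
have [p0 le] := ln_prod_le e0; rewrite ln_ReM ?noise_det_gt0// lerD2l.
apply: (le_trans le); rewrite lerBlDl; apply: (le_trans (Re_le h)).
rewrite ReD Re_nat lerD2l Re_sum; apply: ler_sum => i _.
have -> : (lam i)%:C - 1 = (lam i - 1)%:C by rewrite rmorphB rmorph1.
by rewrite Re_realM ReB.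
Qed.

Lemma ln_det_ge0 :
  0 <= ln (Re (\det (1%:M + diag_mx (\row_i ((lam i)%:C)^-1) *m (G *m G^H)))).
Proof.
have [e [e0 E h]] := noise_inv_eigen G lamC0.
have [p0 le] := ln_prod_le e0.
have := congr1 (fun x => ln (Re x)) E.
rewrite ln_ReM ?noise_det_gt0// ln1 => /esym/eqP; rewrite addr_eq0 => /eqP ->.
rewrite oppr_ge0 (le_trans le)// subr_le0.
by have := Re_le h; rewrite Re_nat.
Qed.

Lemma ln_det_le_tr :
  ln (Re (\det (1%:M + diag_mx (\row_i ((lam i)%:C)^-1) *m (G *m G^H)))) <=
  \sum_i (lam i)^-1 * Re ((G *m G^H) i i).
Proof.
have [e [e0 -> h]] := noise_eigen G lamC0.
have [_ le] := ln_prod_le e0; apply: (le_trans le).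
rewrite h ReD Re_nat addrAC subrr add0r Re_sum.
by apply: ler_sum => i _; rewrite -fmorphV Re_realM.
Qed.

End Noise.

Lemma inv1p_lipschitz (x y : R) : 0 <= x -> 0 <= y ->
  `|(1 + x)^-1 - (1 + y)^-1| <= `|x - y|.
Proof.
move=> x0 y0; have x1 : 0 < 1 + x by rewrite ltr_pwDl.
have y1 : 0 < 1 + y by rewrite ltr_pwDl.
have -> : (1 + x)^-1 - (1 + y)^-1 = (y - x) / ((1 + x) * (1 + y)).
  by field; rewrite !gt_eqF.
rewrite normrM distrC ler_piMr// ger0_norm; last by rewrite invr_ge0 mulr_ge0// ltW.
by rewrite invf_le1 ?mulr_gt0// -[leLHS]mulr1 ler_pM ?ler01// lerDl.
Qed.

Lemma inv1p_perturb (x y z s : R) : 0 <= x -> 0 <= y -> `|z - y| <= s ->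
  `|(1 + x)^-1 - (1 + y)^-1| <= `|x - z| + s.
Proof.
move=> x0 y0 zy; apply: (le_trans (inv1p_lipschitz x0 y0)).
by rewrite -(subrKA z) (le_trans (ler_normD _ _))// lerD2l.
Qed.

(** Writing the entry as 1/(1 + q), the map y -> 1/(1 + y) is 1-Lipschitz, so two errors add up:
    that of q against the weighted trace of K', and that of replacing K' by K. The latter is at most
    [s], as the trace drops by at most 1. *)
Lemma rsv_diag_approx m n (G : 'M[C]_(m, n)) c (a : 'I_m -> R) (s : R) :
  0 <= s -> (forall i, 0 <= a i <= s) ->
  `|Re (rsv G^H c c) - (1 + \sum_i a i * Re (rsv G i i))^-1| <=
  `|Re (qform G c) - \sum_i a i * Re (rsv (col_zero G c) i i)| + s.
Proof.
move=> s0 has.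
have a0 i : 0 <= a i by have /andP[] := has i.
have q0 : 0 <= Re (qform G c) by apply/Re_ge0/qform_ge0.
have -> : Re (rsv G^H c c) = (1 + Re (qform G c))^-1.
  rewrite rsv_diag_qform (ge0_ReE (qform_ge0 G c)).
  by rewrite -(rmorph1 (real_complex R)) -rmorphD -fmorphV.
apply: inv1p_perturb => //.
  by apply: sumr_ge0 => i _; rewrite mulr_ge0//; have /andP[] := Re_rsv_itv G i.
have d0 i : 0 <= Re (rsv (col_zero G c) i i) - Re (rsv G i i).
  by rewrite -ReB; exact/Re_ge0/rsv_col_zero_diff_ge0.
rewrite -sumrB ger0_norm; last by apply: sumr_ge0 => i _; rewrite -mulrBr mulr_ge0.
apply: (@le_trans _ _ (s * \sum_i (Re (rsv (col_zero G c) i i) - Re (rsv G i i)))).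
  rewrite mulr_sumr; apply: ler_sum => i _; rewrite -mulrBr ler_wpM2r//.
  by have /andP[] := has i.
rewrite -[leRHS]mulr1 ler_wpM2l//; under eq_bigr do rewrite -ReB.
by rewrite -Re_sum -[leRHS]/(Re 1); apply/Re_le/rsv_col_zero_diff_sum.
Qed.

(* Real coefficients of [h^H K h] in the real and imaginary parts (tagged [false]
   and [true]) of the entries of [h], scaled by [s] *)
Definition realq m (K : 'M[C]_m) (s : 'I_m -> R) (a b : 'I_m * bool) : R :=
  s a.1 * s b.1 *
  match a.2, b.2 with
  | false, true => - Im (K a.1 b.1)
  | true, false => Im (K a.1 b.1)
  | _, _ => Re (K a.1 b.1)
  end.

Lemma sum_pair_bool m (F : 'I_m * bool -> R) :
  \sum_a F a = \sum_i (F (i, false) + F (i, true)).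
Proof.
transitivity (\sum_i \sum_b F (i, b)); first by rewrite pair_big; apply: eq_bigr => -[].
by apply: eq_bigr => i _; rewrite big_bool addrC.
Qed.

Lemma realqE m (K : 'M[C]_m) (s : 'I_m -> R) (g : 'I_m * bool -> R) (h : 'cV[C]_m) :
  (forall i, h i 0 = (s i)%:C * Complex (g (i, false)) (g (i, true))) ->
  Re ((h^H *m K *m h) 0 0) = \sum_a \sum_b realq K s a b * (g a * g b).
Proof.
move=> hE; rewrite -mulmxA mxE Re_sum sum_pair_bool; apply: eq_bigr => i _.
rewrite !mxE mulr_sumr Re_sum !sum_pair_bool -big_split/=; apply: eq_bigr => j _.
rewrite !hE /realq/=; case: (K i j) => x y.
simpc => /=; ring.
Qed.

Lemma sum_realq_diag m (K : 'M[C]_m) (s : 'I_m -> R) :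
  \sum_a realq K s a a = \sum_i 2 * s i ^+ 2 * Re (K i i).
Proof.
by rewrite sum_pair_bool; apply: eq_bigr => i _; rewrite /realq/=; ring.
Qed.

(** Each entry K_ij becomes a real 2 by 2 block of squared norm 2 |K_ij|^2, and every row of [K] has
    norm at most 1. *)
Lemma sum_realq_sq m n (G : 'M[C]_(m, n)) (s : 'I_m -> R) (t : R) :
  (forall i, s i ^+ 2 <= t) ->
  \sum_a \sum_b realq (rsv G) s a b ^+ 2 <= 2 * t ^+ 2 * m%:R.
Proof.
move=> st; rewrite sum_pair_bool.
apply: (@le_trans _ _ (\sum_(i < m) 2 * t ^+ 2 * Re (\sum_j `|rsv G i j| ^+ 2))); last first.
  rewrite -mulr_sumr; apply: ler_wpM2l; first by rewrite mulr_ge0 ?ler0n ?sqr_ge0.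
  have -> : m%:R = \sum_(i < m) 1 :> R by rewrite sumr_const card_ord.
  by apply: ler_sum => i _; rewrite -[leRHS]/(Re 1); apply/Re_le/rsv_row_le1.
apply: ler_sum => i _; rewrite Re_sum mulr_sumr -big_split/= sum_pair_bool.
apply: ler_sum => j _.
rewrite /realq/=; case: (rsv G i j) => x y /=.
rewrite mul0r subr0 -expr2 sqr_sqrtr ?addr_ge0 ?sqr_ge0//.
have h : s i ^+ 2 * s j ^+ 2 <= t ^+ 2 by rewrite [leRHS]expr2 ler_pM ?sqr_ge0.
rewrite [leLHS](_ : _ = 2 * (s i ^+ 2 * s j ^+ 2 * (x ^+ 2 + y ^+ 2))); last by ring.
by rewrite -[leRHS]mulrA ler_wpM2l ?ler0n// ler_wpM2r ?addr_ge0 ?sqr_ge0.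
Qed.

End RealBounds.

(** * Concentration of the resolvent diagonal *)

Section ComplexMeasurable.
Context {d : measure_display} {T : measurableType d} {R : realType}.
Implicit Types f g : T -> R[i].

Definition cmeas f := measurable_fun setT (fun w => complex.Re (f w)) /\
  measurable_fun setT (fun w => complex.Im (f w)).

Lemma cmeas_cst c : cmeas (fun=> c). Proof. by split; exact: measurable_cst. Qed.

Lemma cmeas_real (f : T -> R) : measurable_fun setT f -> cmeas (fun w => (f w)%:C).
Proof. by move=> mf; split=> //=; exact: measurable_cst. Qed.

Lemma eq_cmeas f g : f =1 g -> cmeas f -> cmeas g.
Proof. by move=> /funext ->. Qed.

Lemma cmeasD f g : cmeas f -> cmeas g -> cmeas (fun w => f w + g w).
Proof.
move=> [f1 f2] [g1 g2]; split.
- rewrite (_ : (fun _ => _) = (fun w => complex.Re (f w) + complex.Re (g w))).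
    exact: measurable_funD.
  by apply/funext => w; case: (f w) (g w) => [? ?] [].
- rewrite (_ : (fun _ => _) = (fun w => complex.Im (f w) + complex.Im (g w))).
    exact: measurable_funD.
  by apply/funext => w; case: (f w) (g w) => [? ?] [].
Qed.

Lemma cmeasM f g : cmeas f -> cmeas g -> cmeas (fun w => f w * g w).
Proof.
move=> [f1 f2] [g1 g2]; split.
- rewrite (_ : (fun _ => _) = (fun w => complex.Re (f w) * complex.Re (g w)
    - complex.Im (f w) * complex.Im (g w))).
    by apply: measurable_funB; exact: measurable_funM.
  by apply/funext => w; case: (f w) (g w) => [? ?] [].
- rewrite (_ : (fun _ => _) = (fun w => complex.Re (f w) * complex.Im (g w)
    + complex.Im (f w) * complex.Re (g w))).
    by apply: measurable_funD; exact: measurable_funM.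
  by apply/funext => w; case: (f w) (g w) => [? ?] [].
Qed.

Lemma cmeas_conj f : cmeas f -> cmeas (fun w => Num.conj (f w)).
Proof.
move=> [f1 f2]; split.
- rewrite (_ : (fun _ => _) = (fun w => complex.Re (f w)))//.
  by apply/funext => w; case: (f w).
- rewrite (_ : (fun _ => _) = (fun w => - complex.Im (f w))).
    exact: measurable_funN.
  by apply/funext => w; case: (f w).
Qed.

Lemma cmeas_sum (I : Type) (r : seq I) (Q : pred I) (F : I -> T -> R[i]) :
  (forall i, cmeas (F i)) -> cmeas (fun w => \sum_(i <- r | Q i) F i w).
Proof.
move=> mF; elim: r => [|i r ih].
  by under eq_fun do rewrite big_nil; exact: cmeas_cst.
under eq_fun do rewrite big_cons.
by case: (Q i) => //; exact: cmeasD.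
Qed.

Lemma cmeas_prod (I : Type) (r : seq I) (Q : pred I) (F : I -> T -> R[i]) :
  (forall i, cmeas (F i)) -> cmeas (fun w => \prod_(i <- r | Q i) F i w).
Proof.
move=> mF; elim: r => [|i r ih].
  by under eq_fun do rewrite big_nil; exact: cmeas_cst.
under eq_fun do rewrite big_cons.
by case: (Q i) => //; exact: cmeasM.
Qed.

Lemma cmeas_det n (A : T -> 'M[R[i]]_n) :
  (forall i j, cmeas (fun w => A w i j)) -> cmeas (fun w => \det (A w)).
Proof.
move=> mA; rewrite /determinant; apply: cmeas_sum => s.
by apply: cmeasM; [exact: cmeas_cst|exact: cmeas_prod].
Qed.

Lemma cmeas_mulmx m n k (A : T -> 'M[R[i]]_(m, n)) (B : T -> 'M[R[i]]_(n, k)) :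
  (forall i j, cmeas (fun w => A w i j)) -> (forall i j, cmeas (fun w => B w i j)) ->
  forall i j, cmeas (fun w => (A w *m B w) i j).
Proof.
move=> mA mB i j; under eq_fun do rewrite mxE.
by apply: cmeas_sum => l; exact: cmeasM.
Qed.

Lemma cmeas_adj m n (A : T -> 'M[R[i]]_(m, n)) :
  (forall i j, cmeas (fun w => A w i j)) -> forall i j, cmeas (fun w => (A w)^H i j).
Proof. by move=> mA i j; under eq_fun do rewrite !mxE; exact: cmeas_conj. Qed.

Lemma cmeas_rsv m n (G : T -> 'M[R[i]]_(m, n)) :
  (forall i j, cmeas (fun w => G w i j)) ->
  forall i j, cmeas (fun w => rsv (G w) i j).
Proof.
move=> mG i j; pose A w := 1%:M + G w *m (G w)^H.
have mA k l : cmeas (fun w => A w k l).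
  under eq_fun do rewrite mxE.
  apply: cmeasD; first exact: cmeas_cst.
  by apply: cmeas_mulmx => //; exact: cmeas_adj.
have uA w : A w \in unitmx by exact: rsv_unit.
have dA w : 0 < \det (A w).
  by apply: psd_det_gt0 (uA w); apply: psdD (psd1 _) (psd_gram _).
(* Cramer's rule. The determinant is a positive real, so its inverse can be written as a real power,
   a measurable function. *)
have rE w : rsv (G w) i j = (powR (complex.Re (\det (A w))) (-1))%:C * cofactor (A w) j i.
  have -> : rsv (G w) = (\det (A w))^-1 *: \adj (A w).
    by rewrite /rsv /invmx uA.
  rewrite mxE mxE powR_inv1; last by rewrite -ler0c -ge0_ReE ltW.
  by rewrite [in LHS](ge0_ReE (ltW (dA w))) -fmorphV.
apply: (eq_cmeas (fun w => esym (rE w))); apply: cmeasM.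
  apply: cmeas_real; have [mdet _] := cmeas_det mA.
  exact: measurableT_comp (measurable_powR (-1)) mdet.
apply: cmeasM; first exact: cmeas_cst.
by apply: cmeas_det => k l; under eq_fun do rewrite 2!mxE; exact: mA.
Qed.

End ComplexMeasurable.

Section ColumnConcentration.
Context {R : realType} {d : measure_display} {T : measurableType d}
  (P : probability T R) (m n : nat).
Variables (g : 'I_m * 'I_n * bool -> {RV P >-> R}) (s : 'I_m -> 'I_n -> R) (t : R).
Hypothesis indg : mutually_independent g.
Hypothesis gaussg : forall i (A : set R), measurable A ->
  distribution P (g i) A = normal_prob 0 (Num.sqrt (2^-1)) A.
Hypothesis t0 : 0 <= t.
Hypothesis st : forall i j, s i j ^+ 2 <= t.

Definition gauss_mx w : 'M[R[i]]_(m, n) :=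
  \matrix_(i, j) ((s i j)%:C * Complex (g (i, j, false) w) (g (i, j, true) w)).

Local Notation G := gauss_mx.
Local Notation tau := (@normal_var R).

Lemma cmeas_gauss_mx i j : cmeas (fun w => G w i j).
Proof.
under eq_fun do rewrite mxE.
by apply: cmeasM; [exact: cmeas_cst|split=> /=; exact: measurable_funPT].
Qed.

Lemma measurable_Re_rsv i : measurable_fun setT (fun w => complex.Re (rsv (G w) i i)).
Proof. by have [] := cmeas_rsv cmeas_gauss_mx i i. Qed.

Lemma measurable_Re_rsvH j : measurable_fun setT (fun w => complex.Re (rsv (G w)^H j j)).
Proof. by have [] := cmeas_rsv (cmeas_adj cmeas_gauss_mx) j j. Qed.

Let phi (c : 'I_n) (a : 'I_m * bool) := (a.1, c, a.2).

Let phi_inj c : injective (phi c).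
Proof. by move=> [a1 a2] [b1 b2] [-> ->]. Qed.

Let q c (a b : 'I_m * bool) w := realq (rsv (col_zero (G w) c)) (s ^~ c) a b.

(** With column [c] zeroed, no coordinate of that column is read; the measurability lemmas are rerun
    over the sigma-algebra generated by the other coordinates. *)
Let q_others c a b e : others_measurable g (phi c e) (q c a b).
Proof.
pose T' := g_sigma_algebraType (others g (phi c e)).
have mz i j : @cmeas _ T' R (fun w => col_zero (G w) c i j).
  under eq_fun do rewrite !mxE.
  have [_|jc] := eqVneq j c; first exact: cmeas_cst.
  apply: cmeasM; first exact: cmeas_cst.
  have ne y : (i, j, y) != phi c e by rewrite !xpair_eqE (negPf jc) andbF.
  by split=> /=; exact: (@others_measurable_coord _ _ _ _ _ g _ _ (ne _)).
have mr k l : @cmeas _ T' R (fun w => rsv (col_zero (G w) c) k l) by exact: cmeas_rsv.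
rewrite /q /realq; apply: measurable_funM; first exact: measurable_cst.
have [m1 m2] := mr a.1 b.1.
by case: a.2; case: b.2 => //; exact: measurable_funN.
Qed.

Let D := 2 * t ^+ 2 * m%:R.

Let q_sum c w : \sum_a \sum_b q c a b w ^+ 2 <= D.
Proof. exact: sum_realq_sq. Qed.

Let q_bound c a b w : `|q c a b w| <= 1 + D.
Proof.
have h : q c a b w ^+ 2 <= D.
  apply: le_trans (q_sum c w); rewrite (bigD1 a)//= (bigD1 b)//= -addrA lerDl.
  rewrite addr_ge0//; first by apply: sumr_ge0 => k _; exact: sqr_ge0.
  by apply: sumr_ge0 => k _; apply: sumr_ge0 => l _; exact: sqr_ge0.
rewrite ler_norml; have h1 := sqr_ge0 (q c a b w - 1); have h2 := sqr_ge0 (q c a b w + 1).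
by apply/andP; split; nra.
Qed.

Let dev c w := \sum_a \sum_b q c a b w * (g (phi c a) w * g (phi c b) w)
  - tau * \sum_a q c a a w.

Let devE c w : complex.Re (qform (G w) c) -
    \sum_i 2 * tau * s i c ^+ 2 * complex.Re (rsv (col_zero (G w) c) i i) = dev c w.
Proof.
rewrite /dev /qform (@realqE _ _ _ (s ^~ c) (fun a => g (phi c a) w)); last first.
  by move=> i; rewrite !mxE.
congr (_ - _); rewrite /q sum_realq_diag mulr_sumr.
by apply: eq_bigr => i _; ring.
Qed.

Definition col_gap c w := complex.Re (rsv (G w)^H c c) -
  (1 + \sum_i 2 * tau * s i c ^+ 2 * complex.Re (rsv (G w) i i))^-1.

Let weight_itv i c : 0 <= 2 * tau * s i c ^+ 2 <= 2 * tau * t.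
Proof.
have tau0 : 0 <= 2 * tau by rewrite mulr_ge0 ?normal_var_ge0.
by apply/andP; split; [apply: mulr_ge0 (sqr_ge0 _)|exact: ler_wpM2l].
Qed.

Let gap_sum_ge0 c w :
  0 <= \sum_i 2 * tau * s i c ^+ 2 * complex.Re (rsv (G w) i i).
Proof.
apply: sumr_ge0 => i _; have /andP[k0 _] := Re_rsv_itv (G w) i.
by apply: mulr_ge0 k0; have /andP[] := weight_itv i c.
Qed.

Lemma intg_col_gap c : intg P (col_gap c).
Proof.
apply: (@intg_bounded _ _ _ P 1).
  apply: measurable_funB; first exact: measurable_Re_rsvH.
  rewrite (_ : (fun _ => _) = (fun w => powR (1 + \sum_i 2 * tau * s i c ^+ 2
      * complex.Re (rsv (G w) i i)) (-1))); last first.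
    by apply/funext => w; rewrite powR_inv1// addr_ge0// gap_sum_ge0.
  apply: measurableT_comp (measurable_powR (-1)) _.
  apply: measurable_funD; first exact: measurable_cst.
  apply: measurable_sum => i; apply: measurable_funM; first exact: measurable_cst.
  exact: measurable_Re_rsv.
move=> w; have /andP[k0 k1] := Re_rsv_itv (G w)^H c; rewrite /col_gap.
have u1 : 1 <= 1 + \sum_i 2 * tau * s i c ^+ 2 * complex.Re (rsv (G w) i i).
  by rewrite lerDl gap_sum_ge0.
set u := 1 + _ in u1 *; have u0 : 0 < u by exact: lt_le_trans u1.
have v0 : 0 <= u^-1 by rewrite invr_ge0 ltW.
have v1 : u^-1 <= 1 by rewrite invf_le1.
by rewrite ler_norml; apply/andP; split; lra.
Qed.

(** In the application [t] is of order 1/n and [m] of order n, so for fixed [eps] the last two terms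
    are O(1/n). *)
Lemma col_gap_L1 c (eps : R) : 0 < eps ->
  Ex P (fun w => `|col_gap c w|) <=
  eps + 2 * normal_bound * (2 * t ^+ 2 * m%:R) / eps + 2 * tau * t.
Proof.
move=> e0; have tau0 := @normal_var_ge0 R.
have gap_le w : `|col_gap c w| <= `|dev c w| + 2 * tau * t.
  by rewrite -devE; apply: rsv_diag_approx; [rewrite !mulr_ge0|move=> i; exact: weight_itv].
have [idev Edev] := quadratic_form_L1 indg tau0
  (fun i => normal_RV4 (gaussg i)) (fun i => normal_RV1 (gaussg i))
  (fun i => normal_RV2 (gaussg i)) (fun i => normal_RVM (gaussg i))
  normal_var_bound (@phi_inj c) (@q_bound c) (@q_others c) (q_sum c) e0.
apply: (@le_trans _ _ (Ex P (fun w => `|dev c w| + 2 * tau * t))).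
  apply: Ex_le gap_le; first exact: (intg_norm (@intg_col_gap c)).
  by apply: intgD (intg_cst _ _); exact: intg_norm.
by rewrite ExD ?Ex_cst ?lerD2r//; [exact: intg_norm|exact: intg_cst].
Qed.

End ColumnConcentration.

(** * The channel matrix *)

Lemma mutually_independent_inj {d} {T : measurableType d} {R : realType}
    (P : probability T R) {I : eqType} (J : finType) (X : I -> {RV P >-> R})
    (f : J -> I) :
  injective f -> mutually_independent X -> mutually_independent (fun j => X (f j)).
Proof.
move=> fI indX s A us mA.
pose A' i := if [pick j | f j == i] is Some j then A j else setT.
have A'E j : A' (f j) = A j.
  rewrite /A'; case: pickP => [k /eqP/fI -> //|/(_ j)]; by rewrite eqxx.
have mA' i : measurable (A' i) by rewrite /A'; case: pickP.
have := indX [seq f j | j <- s] A'; rewrite map_inj_uniq// => /(_ us mA').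
rewrite big_map; under eq_bigr do rewrite A'E; move=> <-; congr (P _).
rewrite eqEsubset; split=> [w h i /= /mapP[j js ->]|w h j /= js].
  by rewrite A'E; exact: h.
by rewrite -A'E; apply: h => /=; exact: map_f.
Qed.

Lemma splitI_inj m n : injective (@splitI m n).
Proof. by move=> x y /enum_val_inj/cast_ord_inj. Qed.

Lemma splitI_surj m n (y : 'I_m * 'I_n) : exists x, @splitI m n x = y.
Proof.
exists (cast_ord (mxvec_cast m n) (enum_rank y)).
by rewrite /splitI cast_ordK enum_rankK.
Qed.

Lemma card_splitI_fiber m n (i : 'I_m) : #|[pred r | (@splitI m n r).1 == i]| = n.
Proof.
have inj : injective (fun a : 'I_n => (i, a)) by move=> ? ? [].
rewrite -[RHS]card_ord -[RHS](fintype.card_image inj) -(fintype.card_image (@splitI_inj m n)).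
apply: eq_card => -[i' a].
apply/fintype.imageP/fintype.imageP => [[r]|[b _ [-> ->]]].
  by rewrite inE => /eqP <- ->; exists (splitI r).2; rewrite // -surjective_pairing.
by have [r rE] := splitI_surj (i, b); exists r; rewrite ?inE rE.
Qed.

Lemma gap_congr (F : fieldType) (x y z : F) : y = z -> x - (1 + y)^-1 = x - (1 + z)^-1.
Proof. by move=> ->. Qed.

Lemma comb_congr (F : fieldType) (a b x y x' y' : F) :
  x = x' -> y = y' -> a * x + b * y = a * x' + b * y'.
Proof. by move=> -> ->. Qed.

Section Model.
Context {R : realType} {d : measure_display} {T : measurableType d}
  (P : probability T R) (X : idx -> {RV P >-> R}).
Hypothesis HXind : mutually_independent X.
Hypothesis HXgauss : forall (i : idx) (A : set R), measurable A ->
     distribution P (X i) A = normal_prob 0 (Num.sqrt (2^-1)) A.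
Context (B A' p q : nat) (hp : (0 < p)%N) (hq : (0 < q)%N)
  (beta : 'I_B -> 'I_A' -> 'I_B -> R) (b0 : nat).

Section FixedSize.
Context (n : nat) (hn : (0 < n)%N).
Let Col : finType := ('I_A' * 'I_B * 'I_(q * n))%type.
Local Notation rows := (B * (p * n))%N.
Local Notation cols := #|{: Col}|.

Definition gidx (x : 'I_rows * 'I_cols * bool) : idx :=
  let r := splitI x.1.1 in let t : Col := enum_val x.1.2 in
  (val r.1, val t.1.1, val t.1.2, val r.2, val t.2, x.2).

Lemma gidx_inj : injective gidx.
Proof.
move=> [[r c] e] [[r' c'] e'] [] /val_inj h1 /val_inj h2 /val_inj h3 /val_inj h4 /val_inj h5 ->.
congr (_, _, _).
- by apply: splitI_inj; rewrite [LHS]surjective_pairing h1 h4 -surjective_pairing.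
- apply: enum_val_inj; move: h2 h3 h5.
  by case: (enum_val c) (enum_val c') => [[? ?] ?] [[? ?] ?] /= -> -> ->.
Qed.

(** Powers enter through their square roots, and blocks before [b0] get gain 0, so the channel
    matrix has the same size for every [b0]. *)
Definition gain (Q : 'I_A' -> 'I_B -> R) (r : 'I_rows) (c : 'I_cols) : R :=
  let t : Col := enum_val c in
  if (b0 <= t.1.1)%N then
    beta (splitI r).1 t.1.1 t.1.2 * Num.sqrt (Q t.1.1 t.1.2 / (q * n)%:R) else 0.

Definition chan Q w := gauss_mx (fun x => X (gidx x)) (gain Q) w.

Lemma MmatE (lam : 'I_B -> R) (Q : 'I_A' -> 'I_B -> R) w :
  (forall b j, 0 <= Q b j) ->
  Mmat X p q beta lam Q b0 n w = 1%:M +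
    diag_mx (\row_i ((lam (splitI i).1)%:C)^-1) *m (chan Q w *m (chan Q w)^H).
Proof.
move=> Q0; apply/matrixP => r r'; rewrite [LHS]mxE [RHS]mxE mxE; congr (_ + _).
rewrite mul_diag_mx !mxE fmorphV; congr (_ * _).
rewrite (reindex (enum_val : 'I_cols -> Col))/=; last first.
  by apply: onW_bij; exact: enum_val_bij.
rewrite big_mkcond/=; apply: eq_bigr => c _; rewrite !mxE /gain.
case: ifP => _; last by rewrite !mul0r.
rewrite /Htil/=; set t : Col := enum_val c.
set y := Num.sqrt _; have yE : (Q t.1.1 t.1.2 / (q * n)%:R) = y ^+ 2.
  by rewrite sqr_sqrtr// divr_ge0.
rewrite yE; set b := beta _ _ _; set b' := beta _ _ _.
change (b%:C * gentry X w (splitI r).1 t.1.1 t.1.2 (splitI r).2 t.2 * (y ^+ 2)%:C *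
   (b'%:C * gentry X w (splitI r').1 t.1.1 t.1.2 (splitI r').2 t.2)^* =
  (b * y)%:C * gentry X w (splitI r).1 t.1.1 t.1.2 (splitI r).2 t.2 *
  ((b' * y)%:C * gentry X w (splitI r').1 t.1.1 t.1.2 (splitI r').2 t.2)^*).
by case: (gentry _ _ _ _ _ _ _) (gentry _ _ _ _ _ _ _) => u v [u' v'];
  simpc; congr (_ +i* _); ring.
Qed.

Lemma chan_tr Q w :
  gauss_mx (fun x => X (gidx (x.1.2, x.1.1, x.2))) (fun c r => gain Q r c) w =
  (chan Q w)^T.
Proof. by apply/matrixP => c r; rewrite !mxE. Qed.

Let gind : mutually_independent (fun x => X (gidx x)).
Proof. exact: mutually_independent_inj gidx_inj HXind. Qed.

Let gindT : mutually_independent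
  (fun x : 'I_cols * 'I_rows * bool => X (gidx (x.1.2, x.1.1, x.2))).
Proof.
apply: (mutually_independent_inj (f := fun x : 'I_cols * 'I_rows * bool =>
  gidx (x.1.2, x.1.1, x.2))) => //.
by move=> [[c r] e] [[c' r'] e'] /gidx_inj [-> -> ->].
Qed.

Definition rowblock (r : 'I_rows) : 'I_B := (splitI r).1.
Definition colblock (c : 'I_cols) : 'I_A' * 'I_B := (enum_val c : Col).1.

Lemma card_colblock jk : #|[pred c | colblock c == jk]| = (q * n)%N.
Proof.
have inj : injective (fun u : 'I_(q * n) => (jk, u)) by move=> ? ? [].
rewrite -[RHS]card_ord -[RHS](fintype.card_image inj).
rewrite -(fintype.card_image (@enum_val_inj _ (mem {: Col}))); apply: eq_card => -[jk' u].
apply/fintype.imageP/fintype.imageP => [[c]|[v _ [-> ->]]].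
  by rewrite inE => /eqP <- ->; exists (enum_val c : Col).2; rewrite // -surjective_pairing.
exists (enum_rank ((jk, v) : Col)); last by rewrite enum_rankK.
by rewrite inE /colblock enum_rankK.
Qed.

Section BlockConstant.
Variable Qb : 'I_A' -> R.
Hypothesis Qb0 : forall b, 0 <= Qb b.
Local Notation Q := (fun b (_ : 'I_B) => Qb b).
Local Notation G := (chan Q).
Local Notation tau := (@normal_var R).

(* Expected squared modulus of a channel entry between base station [m] and group
   [(b, j)]. *)
Definition profile m b j : R :=
  2 * tau * (if (b0 <= val b)%N then beta m b j ^+ 2 * Qb b / (q * n)%:R else 0).

Lemma gain_sq r c : gain Q r c ^+ 2 =
  if (b0 <= val (colblock c).1)%N then
    beta (rowblock r) (colblock c).1 (colblock c).2 ^+ 2 * Qb (colblock c).1 / (q * n)%:R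
  else 0.
Proof.
rewrite /gain /colblock /rowblock; case: ifP => _; last by rewrite expr0n.
by rewrite exprMn sqr_sqrtr ?divr_ge0// mulrA.
Qed.

Lemma profileE r c :
  profile (rowblock r) (colblock c).1 (colblock c).2 = 2 * tau * gain Q r c ^+ 2.
Proof. by rewrite gain_sq. Qed.

Let k w r := complex.Re (rsv (G w) r r).
Let l w c := complex.Re (rsv (G w)^H c c).

Definition gap w :=
  total_gap rowblock colblock (p * n) (q * n) profile (k w) (l w).

(* Rows are handled as the columns of the transposed channel. *)
Let rgap r w := col_gap (fun x : 'I_cols * 'I_rows * bool => X (gidx (x.1.2, x.1.1, x.2)))
  (fun c r => gain Q r c) r w.

Let row_gapE w r : row_gap rowblock colblock profile (k w) (l w) r = rgap r w.
Proof.
have GT := chan_tr Q w.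
rewrite /rgap /col_gap.
rewrite GT.
rewrite (Re_rsv_trH (G w) r).
rewrite /row_gap /k /l.
apply: gap_congr.
apply: eq_bigr => c _.
by rewrite profileE; apply: congr1; exact: (esym (Re_rsv_tr (G w) c)).
Qed.

Let clm_gapE w c : clm_gap rowblock colblock profile (k w) (l w) c =
  col_gap (fun x => X (gidx x)) (gain Q) c w.
Proof.
apply: gap_congr.
by apply: eq_bigr => r _; rewrite profileE.
Qed.

Let Smax := \sum_m \sum_b \sum_j beta m b j ^+ 2 * Qb b.

Let bQ0 m b j : 0 <= beta m b j ^+ 2 * Qb b.
Proof. by apply: mulr_ge0 => //; exact: sqr_ge0. Qed.

Let Smax0 : 0 <= Smax.
Proof. by do 3 (apply: sumr_ge0 => ? _). Qed.

Let gain_le r c : gain Q r c ^+ 2 <= Smax / n%:R.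
Proof.
rewrite gain_sq; case: ifP => _; last by rewrite divr_ge0.
set m := rowblock r; set b := _.1; set j := _.2.
apply: (@le_trans _ _ (beta m b j ^+ 2 * Qb b / n%:R)).
  rewrite ler_wpM2l// lef_pV2 ?posrE ?ltr0n ?muln_gt0 ?hq// ler_nat.
  by rewrite leq_pmull.
rewrite ler_wpM2r ?invr_ge0// /Smax (bigD1 m)//= (bigD1 b)//= (bigD1 j)//=.
rewrite -!addrA lerDl !addr_ge0//; do 3 ?(apply: sumr_ge0 => ? _); exact: bQ0.
Qed.

Let gapE w : gap w = (p * n)%:R^-1 * (\sum_r `|rgap r w|) +
  (q * n)%:R^-1 * (\sum_c `|col_gap (fun x => X (gidx x)) (gain Q) c w|).
Proof.
have h1 : \sum_r `|row_gap rowblock colblock profile (k w) (l w) r| = \sum_r `|rgap r w|.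
  by apply: eq_bigr => r _; exact: (congr1 Num.norm (row_gapE w r)).
have h2 : \sum_c `|clm_gap rowblock colblock profile (k w) (l w) c| =
    \sum_c `|col_gap (fun x => X (gidx x)) (gain Q) c w|.
  by apply: eq_bigr => c _; exact: (congr1 Num.norm (clm_gapE w c)).
exact: comb_congr h1 h2.
Qed.

Let gaussT i (A : set R) : measurable A ->
  distribution P (X i) A = normal_prob 0 (Num.sqrt (2^-1)) A.
Proof. exact: HXgauss. Qed.

Let dims : R := (B * p + A' * B * q)%:R.

(** Dividing the row sum by [p * n] leaves the factor [B], and the column sum by [q * n] the factor
    [A' * B]. [Smax / n] bounds every squared gain, and [n * dims] is the number of rows plus
    columns. *)
Definition gap_const : R :=
  (B + A' * B)%:R * (1 + 2 * normal_bound * (2 * Smax ^+ 2 * dims) + 2 * tau * Smax).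

Let nR : 0 < n%:R :> R. Proof. by rewrite ltr0n. Qed.

Let Sn0 : 0 <= Smax / n%:R. Proof. by rewrite divr_ge0. Qed.

Let bound0 : 0 <= @normal_bound R.
Proof. exact: le_trans (sqr_ge0 _) normal_var_bound. Qed.

Lemma gap_const_ge0 : 0 <= gap_const.
Proof.
have t0 := @normal_var_ge0 R.
have h1 : 0 <= 2 * normal_bound * (2 * Smax ^+ 2 * dims).
  by apply: mulr_ge0; apply: mulr_ge0 => //; apply: mulr_ge0 => //; exact: sqr_ge0.
have h2 : 0 <= 2 * normal_var * Smax by apply: mulr_ge0 => //; exact: mulr_ge0.
exact: mulr_ge0 (ler0n _ _) (addr_ge0 (addr_ge0 ler01 h1) h2).
Qed.

Let err eps : R := eps + (1 + eps^-1) / n%:R.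
Let K1 : R := 1 + 2 * normal_bound * (2 * Smax ^+ 2 * dims) + 2 * tau * Smax.

Let err_bound eps (N : nat) : 0 < eps -> (N%:R : R) <= n%:R * dims ->
  eps + 2 * normal_bound * (2 * (Smax / n%:R) ^+ 2 * N%:R) / eps +
    2 * tau * (Smax / n%:R) <= K1 * err eps.
Proof.
move=> e0 Nd; have tau0 := @normal_var_ge0 R.
have d0 : 0 <= dims by exact: ler0n.
have ie : 0 < eps^-1 by rewrite invr_gt0.
have iN : 0 < (n%:R : R)^-1 by rewrite invr_gt0.
set a := 2 * normal_bound * (2 * Smax ^+ 2 * dims); set b := 2 * tau * Smax.
have a0 : 0 <= a by rewrite !mulr_ge0// sqr_ge0.
have b0' : 0 <= b by rewrite !mulr_ge0.
apply: (@le_trans _ _ (eps + a * (eps^-1 / n%:R) + b / n%:R)).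
  rewrite (mulrA (2 * tau)) lerD2r lerD2l.
  have -> : a * (eps^-1 / n%:R) = 2 * normal_bound * (2 * (Smax / n%:R) ^+ 2 * (n%:R * dims)) / eps.
    by rewrite /a; field; rewrite !gt_eqF.
  rewrite ler_wpM2r ?(ltW ie)// ler_wpM2l ?mulr_ge0// ler_wpM2l// mulr_ge0//.
  exact: sqr_ge0.
rewrite /K1 -/a -/b /err.
set u := eps^-1 / n%:R; have u0 : 0 <= u by rewrite mulr_ge0 ?ltW.
have -> : (1 + eps^-1) / n%:R = n%:R^-1 + u by rewrite mulrDl mul1r.
by set v := n%:R^-1 in iN *; nra.
Qed.

Lemma Ex_gap eps : 0 < eps ->
  intg P gap /\ Ex P gap <= gap_const * (eps + (1 + eps^-1) / n%:R).
Proof.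
move=> e0.
have ir r : intg P (fun w => `|rgap r w|).
  apply: intg_norm; apply: (@intg_col_gap _ _ _ P _ _ _ _ (Smax / n%:R)) => //.
have ic c : intg P (fun w => `|col_gap (fun x => X (gidx x)) (gain Q) c w|).
  by apply: intg_norm; exact: (@intg_col_gap _ _ _ P _ _ _ _ (Smax / n%:R)).
have -> : gap = (fun w => (p * n)%:R^-1 * (\sum_r `|rgap r w|) +
  (q * n)%:R^-1 * (\sum_c `|col_gap (fun x => X (gidx x)) (gain Q) c w|)).
  by apply/funext => w; exact: gapE.
have i1 : intg P (fun w => \sum_r `|rgap r w|) by exact: intg_sum.
have i2 : intg P (fun w => \sum_c `|col_gap (fun x => X (gidx x)) (gain Q) c w|).
  exact: intg_sum.
split; first by apply: intgD; exact: intgZ.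
rewrite ExD ?ExZ ?Ex_sum//; [|exact: intgZ..].
have hr r : Ex P (fun w => `|rgap r w|) <= K1 * err eps.
  apply: (le_trans (col_gap_L1 gindT (fun x : _ * _ * _ => @gaussT _) Sn0
    (fun c r' => gain_le r' c) r e0)).
  apply: err_bound => //; rewrite -natrM ler_nat !card_prod !card_ord.
  by rewrite mulnDr (mulnA _ q n) (mulnC (A' * B * q)%N n) leq_addl.
have hc c : Ex P (fun w => `|col_gap (fun x => X (gidx x)) (gain Q) c w|) <= K1 * err eps.
  apply: (le_trans (col_gap_L1 gind (fun x : _ * _ * _ => @gaussT _) Sn0 gain_le c e0)).
  apply: err_bound => //; rewrite -natrM ler_nat.
  by rewrite mulnDr (mulnA B p n) (mulnC (B * p)%N n) leq_addr.
rewrite /gap_const -/K1 natrD -mulrA mulrDl -/(err eps); apply: lerD.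
- rewrite mulrC ler_pdivrMr ?ltr0n ?muln_gt0 ?hp//.
  apply: (le_trans (ler_sum _ (fun r _ => hr r))).
  by rewrite sumr_const card_ord -[leLHS]mulr_natl (natrM _ B) (mulrAC B%:R).
- rewrite mulrC ler_pdivrMr ?ltr0n ?muln_gt0 ?hq//.
  apply: (le_trans (ler_sum _ (fun c _ => hc c))).
  by rewrite sumr_const card_ord !card_prod !card_ord -[leLHS]mulr_natl (natrM _ (A' * B)) (mulrAC (A' * B)%:R).
Qed.

End BlockConstant.
End FixedSize.
End Model.

Lemma gauss_mx_gram_diag {R : realType} {d} {T : measurableType d}
    (P : probability T R) m n (g : 'I_m * 'I_n * bool -> {RV P >-> R}) s w i :
  complex.Re ((gauss_mx g s w *m (gauss_mx g s w)^H) i i) =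
  \sum_j s i j ^+ 2 * (g (i, j, false) w ^+ 2 + g (i, j, true) w ^+ 2).
Proof.
rewrite mxE Re_sum; apply: eq_bigr => j _; rewrite !mxE.
by simpc => /=; ring.
Qed.

Lemma unit_noise {R : realType} m (A : 'M[R[i]]_m) :
  diag_mx (\row_i ((1 : R)%:C)^-1) *m A = A.
Proof.
have -> : \row_(i < m) ((1 : R)%:C)^-1 = const_mx 1 :> 'rV[R[i]]_m.
  by apply/rowP => i; rewrite !mxE rmorph1 invr1.
by rewrite diag_const_mx mul1mx.
Qed.

(** * Comparison of the expected log-determinants *)

Section Model.
Context {R : realType} {d : measure_display} {T : measurableType d}
  (P : probability T R) (X : idx -> {RV P >-> R}).
Hypothesis HXind : mutually_independent X.
Hypothesis HXgauss : forall (i : idx) (A : set R), measurable A ->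
     distribution P (X i) A = normal_prob 0 (Num.sqrt (2^-1)) A.
Context (B A' p q : nat) (hp : (0 < p)%N) (hq : (0 < q)%N)
  (beta : 'I_B -> 'I_A' -> 'I_B -> R) (b0 n : nat) (hn : (0 < n)%N).
Local Notation logdet lam Q w := (logdet X p q beta lam Q b0 n w).
Local Notation chan := (chan X p q beta b0 n).
Local Notation rowblock := (@rowblock B p n).
Local Notation colblock := (@colblock B A' q n).

Lemma logdetE lam Q w : (forall b j, 0 <= Q b j) ->
  logdet lam Q w = ln (complex.Re (\det (1%:M +
    diag_mx (\row_i ((lam (rowblock i))%:C)^-1) *m (chan Q w *m (chan Q w)^H)))).
Proof. by move=> Q0; rewrite /Defs.logdet MmatE. Qed.

Lemma logdet1E Q w : (forall b j, 0 <= Q b j) ->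
  logdet (fun=> 1) Q w = ln (complex.Re (\det (1%:M + chan Q w *m (chan Q w)^H))).
Proof.
move=> Q0; apply: (etrans (logdetE (fun=> 1) w Q0)).
exact: (congr1 (fun D => ln (complex.Re (\det (1%:M + D)))) (unit_noise _)).
Qed.

Lemma intg_logdet lam Q : (forall m, 0 < lam m) -> (forall b j, 0 <= Q b j) ->
  intg P (fun w => logdet lam Q w).
Proof.
move=> lam0 Q0; have -> : (fun w => logdet lam Q w) = (fun w => ln (complex.Re (\det (1%:M +
    diag_mx (\row_i ((lam (rowblock i))%:C)^-1) *m (chan Q w *m (chan Q w)^H))))).
  by apply/funext => w; exact: logdetE.
pose g (x : 'I_(B * (p * n)) * 'I_#|{: 'I_A' * 'I_B * 'I_(q * n)}| * bool) := X (gidx x).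
have cG i j : cmeas (fun w => chan Q w i j) by exact: cmeas_gauss_mx.
apply: (@intg_le _ _ _ P _ (fun w => \sum_i (lam (rowblock i))^-1 *
   \sum_j gain beta b0 Q i j ^+ 2 * (g (i, j, false) w ^+ 2 + g (i, j, true) w ^+ 2))).
- apply: measurableT_comp; first exact: measurable_ln.
  have [] // : cmeas (fun w => \det (1%:M +
    diag_mx (\row_i ((lam (rowblock i))%:C)^-1) *m (chan Q w *m (chan Q w)^H))).
  apply: cmeas_det => i j; under eq_fun do rewrite mxE.
  apply: cmeasD; first exact: cmeas_cst.
  apply: cmeas_mulmx => [k l|]; first exact: cmeas_cst.
  by apply: cmeas_mulmx => //; exact: cmeas_adj.
- apply: intg_sum => i; apply: intgZ; apply: intg_sum => j; apply: intgZ.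
  by apply: intgD; exact: (normal_RV2_intg (@HXgauss _)).
- move=> w; rewrite ger0_norm; last by apply: ln_det_ge0.
  apply: (le_trans (ln_det_le_tr _ _)); first by move=> i; exact: lam0.
  apply: ler_sum => i _; apply: ler_wpM2l; first by rewrite invr_ge0 ltW.
  by rewrite gauss_mx_gram_diag.
Qed.

Section Comparison.
Variables (Q : 'I_A' -> 'I_B -> R) (Qb : 'I_A' -> R) (k : 'I_A' -> 'I_B -> R).
Hypothesis Qb0 : forall b, 0 <= Qb b.
Hypothesis k0 : forall b j, 0 <= 1 + k b j.
Hypothesis QE : forall b j, Q b j = Qb b * (1 + k b j).
Hypothesis k_sum : forall b, \sum_j k b j = 0.
Variables (Rs Cs : 'I_A' -> R).
Hypothesis rsum : forall m b, \sum_j beta m b j ^+ 2 = Rs b.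
Hypothesis csum : forall b j, \sum_m beta m b j ^+ 2 = Cs b.
Local Notation Qc := (fun b (_ : 'I_B) => Qb b).
Local Notation G w := (chan Qc w).

Let Q0 b j : 0 <= Q b j. Proof. by rewrite QE mulr_ge0. Qed.

Lemma chan_power w : chan Q w =
  G w *m diag_mx (\row_c (Num.sqrt (1 + k (colblock c).1 (colblock c).2))%:C).
Proof.
apply/matrixP => r c; rewrite mul_mx_diag !mxE mulrAC; congr (_ * _).
rewrite -rmorphM/= /gain; case: ifP => _; last by rewrite mul0r.
by rewrite QE -/(colblock c) mulrAC sqrtrM ?divr_ge0// mulrA.
Qed.

Lemma gram_power w : chan Q w *m (chan Q w)^H =
  G w *m diag_mx (\row_c (1 + (k (colblock c).1 (colblock c).2)%:C)) *m (G w)^H.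
Proof.
rewrite chan_power adjM adj_diag !mulmxA; congr (_ *m _); rewrite -mulmxA; congr (_ *m _).
rewrite mulmx_diag; congr diag_mx; apply/rowP => c; rewrite !mxE.
set y := 1 + k _ _.
rewrite -(rmorph1 (real_complex R)) -rmorphD/= -/y.
have yE : Num.sqrt y * Num.sqrt y = y by rewrite -expr2 sqr_sqrtr// /y.
by simpc; rewrite yE.
Qed.

(** Row and column sums of the profile weighted by the block sizes. The factor [n] cancels, so the
    stability constants are uniform in [n]. *)
Let vr b : R := 2 * normal_var * (if (b0 <= val b)%N then Rs b * Qb b else 0).
Let uc b : R := p%:R / q%:R * (2 * normal_var * (if (b0 <= val b)%N then Cs b * Qb b else 0)).

Definition compare_const (lam : 'I_B -> R) : R :=
  p%:R * ((\sum_m `|lam m - 1|) * fix_const vr) +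
  q%:R * ((\sum_x `|k x.1 x.2|) *
    ((\sum_b uc b) * fix_const vr + 2)).

Let nz : (n%:R : R) != 0. Proof. by rewrite pnatr_eq0 -lt0n. Qed.
Let qz : (q%:R : R) != 0. Proof. by rewrite pnatr_eq0 -lt0n. Qed.

Let profile_ge0 m b j : 0 <= profile q beta b0 n Qb m b j.
Proof.
rewrite mulr_ge0 ?mulr_ge0 ?normal_var_ge0//; case: ifP => // _.
by rewrite divr_ge0// mulr_ge0// sqr_ge0.
Qed.

Let profile_row m b : \sum_j (q * n)%:R * profile q beta b0 n Qb m b j = vr b.
Proof.
rewrite /vr -(rsum m); rewrite /profile; case: ifP => hb.
  rewrite mulr_suml mulr_sumr; apply: eq_bigr => j _; rewrite natrM.
  by field; rewrite nz qz.
by rewrite big1 ?mulr0// => j _; rewrite !mulr0.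
Qed.

Let profile_col b j : \sum_m (p * n)%:R * profile q beta b0 n Qb m b j = uc b.
Proof.
rewrite /uc -(csum b j); rewrite /profile; case: ifP => hb.
  rewrite mulr_suml !mulr_sumr; apply: eq_bigr => m _; rewrite !natrM.
  by field; rewrite nz qz.
by rewrite big1 ?mulr0// => m _; rewrite !mulr0.
Qed.

Let uc0 (m0 : 'I_B) b : 0 <= uc b.
Proof.
rewrite -(profile_col b m0); apply: sumr_ge0 => m _.
by rewrite mulr_ge0 ?profile_ge0.
Qed.

Lemma logdet_compare (lam : 'I_B -> R) (m0 : 'I_B) w :
  (forall m, 0 < lam m) -> \sum_m (lam m - 1) = 0 ->
  logdet (fun=> 1) Q w <=
  logdet lam Qc w + n%:R * (compare_const lam * gap X p q beta b0 n Qb w).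
Proof.
move=> lam0 lam_sum.
have K01 r : 0 <= complex.Re (rsv (G w) r r) <= 1 by exact: Re_rsv_itv.
have L01 c : 0 <= complex.Re (rsv (G w)^H c c) <= 1 by exact: Re_rsv_itv.
have pn0 : (0 < p * n)%N by rewrite muln_gt0 hp.
have qn0 : (0 < q * n)%N by rewrite muln_gt0 hq.
have [hx ht] := @block_fixpoint R 'I_B 'I_A' 'I_B _ _ rowblock colblock (p * n) (q * n) pn0 qn0
  (@card_splitI_fiber _ _) (@card_colblock _ _ _ _)
  (profile q beta b0 n Qb) vr uc _ _ profile_ge0 profile_row profile_col (uc0 m0) K01 L01 m0.
set K := fun r => complex.Re (rsv (G w) r r) in K01 hx.
set L := fun c => complex.Re (rsv (G w)^H c c) in L01 ht.
have hA : logdet (fun=> 1) Q w <= logdet (fun=> 1) Qc w +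
    \sum_c (fun x => k x.1 x.2) (colblock c) * (1 - L c).
  rewrite (logdet1E w Q0) (logdet1E w (fun b _ => Qb0 b)) gram_power.
  exact: (ln_det_power (G w) (fun c => k0 _ _)).
have hB : logdet (fun=> 1) Qc w <= logdet lam Qc w +
    \sum_r (fun m => lam m - 1) (rowblock r) * (1 - K r).
  rewrite (logdet1E w (fun b _ => Qb0 b)) (logdetE lam w (fun b _ => Qb0 b)).
  exact: (ln_det_noise (G w) (fun r => lam0 (rowblock r))).
have g0 : 0 <= gap X p q beta b0 n Qb w.
  by rewrite addr_ge0// mulr_ge0 ?invr_ge0// sumr_ge0.
have fc0 : 0 <= fix_const vr.
  rewrite /fix_const mulr_ge0// addr_ge0// mulr_ge0// sumr_ge0// => b _.
  by rewrite -(profile_row m0 b) sumr_ge0// => j _; rewrite mulr_ge0 ?profile_ge0.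
(* The reference is the average at base station [m0], a constant against which [lam - 1] sums to
   0. *)
have h1 := @sum_centered_le R 'I_B _ rowblock (p * n) pn0 (@card_splitI_fiber _ _)
  (fun m => lam m - 1) (fun=> block_avg rowblock (p * n) K m0) K _ _ (fun m => hx m m0).
(* Here the reference may vary with the block, since [k] sums to 0 inside each block. Summing [uc]
   over all blocks makes the constant uniform in the block. *)
have h2 := @sum_centered_le R _ _ colblock (q * n) qn0 (@card_colblock _ _ _ _)
  (fun x => k x.1 x.2) (fun x => block_avg colblock (q * n) L (x.1, m0)) L
  (((\sum_b uc b) * fix_const vr + 2) * gap X p q beta b0 n Qb w).
apply: (le_trans hA); rewrite addrC -lerBrDl; apply: (le_trans hB).
rewrite lerBrDr -addrA lerD2l.
have -> : n%:R * (compare_const lam * gap X p q beta b0 n Qb w) =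
  (p * n)%:R * ((\sum_m `|lam m - 1|) * (fix_const vr * gap X p q beta b0 n Qb w)) +
  (q * n)%:R * ((\sum_x `|k x.1 x.2|) *
    (((\sum_b uc b) * fix_const vr + 2) * gap X p q beta b0 n Qb w)).
  by rewrite /compare_const !natrM; ring.
apply: lerD; first by apply: h1; rewrite -mulr_suml lam_sum mul0r.
apply: h2 => [|[b j]].
  rewrite -(pair_bigA _ (fun b j => k b j * (1 - block_avg colblock (q * n) L (b, m0))))/=.
  by rewrite big1// => b _; rewrite -mulr_suml k_sum mul0r.
apply: (le_trans (ht b j m0)); apply: (ler_wpM2r g0); rewrite lerD2r.
apply: (ler_wpM2r fc0); rewrite (bigD1 b)//= lerDl.
by apply: sumr_ge0 => b' _; exact: uc0.
Qed.

Lemma compare_const_ge0 (lam : 'I_B -> R) (m0 : 'I_B) : 0 <= compare_const lam.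
Proof.
have fc0 : 0 <= fix_const vr.
  rewrite /fix_const mulr_ge0// addr_ge0// mulr_ge0// sumr_ge0// => b _.
  by rewrite -(profile_row m0 b) sumr_ge0// => j _; rewrite mulr_ge0 ?profile_ge0.
have sc : 0 <= \sum_b uc b by apply: sumr_ge0 => b _; exact: uc0.
have s1 : 0 <= \sum_m `|lam m - 1| by apply: sumr_ge0.
have s2 : 0 <= \sum_x `|k x.1 x.2| by apply: sumr_ge0.
apply: addr_ge0; first exact: mulr_ge0 (ler0n _ _) (mulr_ge0 s1 fc0).
apply: mulr_ge0 (ler0n _ _) (mulr_ge0 s2 _).
exact: addr_ge0 (mulr_ge0 sc fc0) (ler0n _ _).
Qed.

Lemma ElogDet_compare (lam : 'I_B -> R) (m0 : 'I_B) eps :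
  (forall m, 0 < lam m) -> \sum_m (lam m - 1) = 0 -> 0 < eps ->
  ElogDet X p q beta (fun=> 1) Q b0 n <= ElogDet X p q beta lam Qc b0 n +
    n%:R * (compare_const lam * gap_const p q beta Qb * (eps + (1 + eps^-1) / n%:R)).
Proof.
move=> lam0 lam_sum e0.
have [ig Eg] := Ex_gap HXind HXgauss hp hq beta b0 hn Qb0 e0.
have i1 := intg_logdet (fun=> @ltr01 R) Q0.
have i2 := intg_logdet lam0 (fun b (_ : 'I_B) => Qb0 b).
apply: (@le_trans _ _ (Ex P (fun w => logdet lam Qc w +
    n%:R * (compare_const lam * gap X p q beta b0 n Qb w)))).
  apply: (Ex_le i1 (intgD i2 (intgZ _ (intgZ _ ig)))) => w.
  exact: logdet_compare m0 w lam0 lam_sum.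
rewrite ExD//; last by do 2 apply: intgZ.
rewrite ExZ ?ExZ//; last exact: intgZ.
rewrite lerD2l ler_wpM2l// -mulrA ler_wpM2l//.
exact: (compare_const_ge0 _ m0).
Qed.

End Comparison.
End Model.

(** * The large-system limit *)

(** [eps] is fixed first, small against [e / C], and only then [n] is taken large enough for (1 +
    1/eps)/n to fall below [eps]; [C + 1] covers C = 0. *)
Lemma limn_le_vanishing {R : realType} (u v : nat -> R) (C : R) :
  0 <= C -> cvgn u -> cvgn v ->
  (forall eps n, 0 < eps -> (0 < n)%N -> u n <= v n + C * (eps + (1 + eps^-1) / n%:R)) ->
  limn u <= limn v.
Proof.
move=> C0 cu cv h; apply/ler_addgt0Pr => e e0.
pose eps := e / (2 * (C + 1)).
have C1 : 0 < C + 1 by rewrite ltr_wpDl.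
have eps0 : 0 < eps by rewrite divr_gt0// mulr_gt0.
have cvv : v n + e @[n --> \oo] --> limn v + e by apply: cvgD => //; exact: cvg_cst.
rewrite -(cvg_lim (@Rhausdorff R) cvv); apply: ler_lim => //; first by apply/cvg_ex; eexists; exact: cvv.
near=> n.
have n0 : (0 < n)%N by near: n; exact: nbhs_infty_gt.
have nR : (0 : R) < n%:R by rewrite ltr0n.
have small : (1 + eps^-1) / n%:R <= eps.
  rewrite ler_pdivrMr// mulrC -ler_pdivrMr//; near: n; exact: nbhs_infty_ger.
apply: (le_trans (h eps n eps0 n0)); rewrite lerD2l.
have -> : e = (C + 1) * (eps + eps) by rewrite /eps; field; rewrite gt_eqF.
apply: ler_pM => //; [|by rewrite lerDl|by rewrite lerD2l].
have pe : 0 <= 1 + eps^-1 by rewrite addr_ge0// invr_ge0 ltW.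
exact: addr_ge0 (ltW eps0) (divr_ge0 pe (ltW nR)).
Unshelve. all: by end_near. Qed.

Section Model.
Context {R : realType} {d : measure_display} {T : measurableType d}
  (P : probability T R) (X : idx -> {RV P >-> R}).
Hypothesis HXind : mutually_independent X.
Hypothesis HXgauss : forall (i : idx) (A : set R), measurable A ->
     distribution P (X i) A = normal_prob 0 (Num.sqrt (2^-1)) A.
Context (B A' p q : nat) (hB : (0 < B)%N) (hp : (0 < p)%N) (hq : (0 < q)%N)
  (beta : 'I_B -> 'I_A' -> 'I_B -> R).
Variables (Rs Cs : 'I_A' -> R).
Hypothesis rsum : forall m b, \sum_j beta m b j ^+ 2 = Rs b.
Hypothesis csum : forall b j, \sum_m beta m b j ^+ 2 = Cs b.
Variable W' : nat -> R.
Hypothesis Delta0 : forall b : 'I_A', 0 <= Delta W' b.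
Local Notation Fn := (Fn X p q beta W').

Definition block_mean (Q : 'I_A' -> 'I_B -> R) b := B%:R^-1 * \sum_j Q b j.

Let BR : (B%:R : R) != 0. Proof. by rewrite pnatr_eq0 -lt0n. Qed.

Lemma sum_block_mean (Q : 'I_A' -> 'I_B -> R) b :
  \sum_(j < B) block_mean Q b = \sum_j Q b j.
Proof. by rewrite sumr_const card_ord -mulr_natl /block_mean mulrA mulfV ?mul1r. Qed.

Lemma Finf_block_mean (lam : 'I_B -> R) Q :
  (forall m, 0 < lam m) -> \sum_m (lam m - 1) = 0 -> (forall b j, 0 <= Q b j) ->
  cvgn (Fn (fun=> 1) Q) -> cvgn (Fn lam (fun b _ => block_mean Q b)) ->
  Finf X p q beta W' (fun=> 1) Q <= Finf X p q beta W' lam (fun b _ => block_mean Q b).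
Proof.
move=> lam0 lam_sum Q0 cu cv.
pose Qb := block_mean Q.
(* If the mean power of a block is 0, all its powers vanish, and the relative deviation 0 is
   consistent with [QE]. *)
pose k b j := if Qb b == 0 then 0 else Q b j / Qb b - 1.
have Qb0 b : 0 <= Qb b by rewrite mulr_ge0 ?invr_ge0// sumr_ge0.
have k0 b j : 0 <= 1 + k b j.
  by rewrite /k; case: ifP => _; rewrite ?addr0// addrC subrK divr_ge0.
have QE b j : Q b j = Qb b * (1 + k b j).
  rewrite /k; case: eqP => [q0|/eqP q0]; last by field.
  rewrite q0 mul0r; apply/eqP; rewrite eq_le Q0 andbT -q0.
  have : \sum_j Q b j = 0 by rewrite -sum_block_mean -/(Qb b) q0 sumr_const mul0rn.
  by rewrite q0 => <-; rewrite (bigD1 j)//= lerDl sumr_ge0.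
have ks b : \sum_j k b j = 0.
  rewrite /k; case: eqP => [q0|/eqP q0]; first by rewrite big1.
  rewrite sumrB -mulr_suml -sum_block_mean -/(Qb b) !sumr_const !card_ord.
  by rewrite -[Qb b *+ B]mulr_natl -mulrA mulfV// mulr1 subrr.
pose c (b : 'I_A') := compare_const p q b Qb k Rs Cs lam * gap_const p q beta Qb.
pose m0 := Ordinal hB.
have c0 b : 0 <= c b.
  apply: mulr_ge0; last exact: gap_const_ge0.
  exact: (compare_const_ge0 p hq b (ltnSn 0) k Qb0 rsum csum lam m0).
apply: (@limn_le_vanishing _ _ _ (\sum_(b < A') Delta W' b / q%:R * c b)) => //.
  by apply: sumr_ge0 => b _; rewrite mulr_ge0// divr_ge0.
move=> eps n e0 n0; rewrite /Defs.Fn mulr_suml -big_split/=; apply: ler_sum => b _.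
have := ElogDet_compare HXind HXgauss hp hq b n0 Qb0 k0 QE ks rsum csum m0 lam0 lam_sum e0.
have D0 : 0 <= Delta W' b / (q * n)%:R by rewrite divr_ge0.
move=> /(ler_wpM2l D0); rewrite mulrDr => /le_trans; apply.
rewrite lerD2l -/(c b).
have nz : (n%:R : R) != 0 by rewrite pnatr_eq0 -lt0n.
have qz : (q%:R : R) != 0 by rewrite pnatr_eq0 -lt0n.
rewrite le_eqVlt natrM; apply/orP; left; apply/eqP.
rewrite -/Qb; set e := eps + _; rewrite invfM -!mulrA; congr (_ * (_ * _)).
by rewrite (mulrCA n%:R^-1) mulVKf// ?mulrA.
Qed.

End Model.

(** * Strong symmetry and the conclusion *)

Lemma perm_map_sum {R : nzRingType} (I : finType) (f g : I -> R) :
  perm_eq [seq f j | j <- enum I] [seq g j | j <- enum I] ->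
  \sum_j f j ^+ 2 = \sum_j g j ^+ 2.
Proof.
move=> fg.
have E (h : I -> R) : \sum_j h j ^+ 2 = \sum_(x <- [seq h j | j <- enum I]) x ^+ 2.
  by rewrite big_map big_enum.
by rewrite !E; exact: perm_big fg.
Qed.

Theorem theorem2 (R : realType) (d : measure_display) (T : measurableType d)
  (P : probability T R) (X : idx -> {RV P >-> R})
  (HXind : mutually_independent X)
  (HXgauss : forall (i : idx) (A : set R), measurable A ->
     distribution P (X i) A = normal_prob 0 (Num.sqrt (2^-1)) A)
  (B A' p q : nat) (hB : (0 < B)%N) (hp : (0 < p)%N) (hq : (0 < q)%N)
  (hpq : coprime p q)
  (beta : 'I_B -> 'I_A' -> 'I_B -> R)
  (hbeta : forall m b j, 0 < beta m b j)
  (hrows : forall (b : 'I_A') (m0 m : 'I_B), val m0 = 0%N ->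
     perm_eq [seq beta m b j | j <- enum 'I_B] [seq beta m0 b j | j <- enum 'I_B])
  (hcols : forall (b : 'I_A') (j0 j : 'I_B), val j0 = 0%N ->
     perm_eq [seq beta m b j | m <- enum 'I_B] [seq beta m b j0 | m <- enum 'I_B])
  (W' : nat -> R) (hW0 : 0 <= W' 0%N)
  (hWmono : forall b : nat, (b.+1 < A')%N -> W' b <= W' b.+1)
  (Pw : R) (hPw : 0 < Pw)
  (hFex : forall (lam : 'I_B -> R) (Q : 'I_A' -> 'I_B -> R),
     (forall m, 0 < lam m) -> (forall b j, 0 <= Q b j) ->
     cvgn (Fn X p q beta W' lam Q)) :
  forall lam : 'I_B -> R, (forall m, 0 < lam m) ->
    B%:R^-1 * \sum_m lam m = 1 ->
    (Gfun X p q beta W' Pw (fun _ => 1%R) <= Gfun X p q beta W' Pw lam)%E.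
Proof.
move=> lam lam0 lam1.
have BR : (B%:R : R) != 0 by rewrite pnatr_eq0 -lt0n.
have lamB : \sum_m lam m = B%:R.
  by rewrite -[LHS](mulVKf BR) lam1 mulr1.
have lam_sum : \sum_m (lam m - 1) = 0.
  by rewrite sumrB lamB sumr_const card_ord subrr.
pose m0 := Ordinal hB.
have rsum m b : \sum_j beta m b j ^+ 2 = \sum_j beta m0 b j ^+ 2.
  exact: perm_map_sum (hrows b m0 m erefl).
have csum b j : \sum_m beta m b j ^+ 2 = \sum_m beta m b m0 ^+ 2.
  exact: (@perm_map_sum _ _ (fun m => beta m b j) (fun m => beta m b m0) (hcols b m0 j erefl)).
(* Block index 0 falls under the convention that the weight before it is 0, so there the increment
   is [W' 0] itself. *)
have D0 (b : 'I_A') : 0 <= Delta W' b.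
  case: b => -[|b] bA; rewrite /Delta/= ?subr0//.
  by rewrite subr_ge0 hWmono.
(* No maximizer is chosen: each value of the objective at unit noise is dominated separately. *)
apply: ub_ereal_sup => _ [Q [Q0 Qsum] <-].
have Qb0 b j : 0 <= (fun b (_ : 'I_B) => block_mean Q b) b j.
  by rewrite mulr_ge0 ?invr_ge0// sumr_ge0.
apply: (@le_trans _ _ (Finf X p q beta W' lam (fun b _ => block_mean Q b))%:E).
  rewrite lee_fin; apply: (Finf_block_mean HXind HXgauss hB hp hq rsum csum D0 lam0 lam_sum Q0).
    by apply: hFex.
  exact: hFex.
apply: ereal_sup_ubound; exists (fun b _ => block_mean Q b) => //; split=> //.
under eq_bigr do rewrite sum_block_mean//.
apply: (le_trans Qsum).
by rewrite -!mulr_suml lamB sumr_const card_ord.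
Qed.
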